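(* There exists $\theta_0\in(0,1)$ such that, for every $\theta\in(0,\theta_0)$, there is a family $(U_\varepsilon)_{\varepsilon\in(0,1)}$ of functions $U_\varepsilon=(U_{1,\varepsilon},U_{2,\varepsilon}):\mathbb{R}\to\mathbb{R}^2$ with the following properties. For every $\varepsilon\in(0,1)$, $U_\varepsilon$ is a $\frac{2\pi}{\theta}$-periodic solution of the system $$u''=\nabla_u W_\varepsilon(u)\quad\text{on }\mathbb{R},\qquad W_\varepsilon(u_1,u_2)=\frac14(1-u_1^2-u_2^2)^2+\frac{\varepsilon}{2}u_1^2u_2^2,$$ such that $$U_{1,\varepsilon}\left(\frac{\pi}{2\theta}-x\right)=U_{2,\varepsilon}(x)>0,\qquad x\in\left(0,\frac{\pi}{2\theta}\right),$$ and $$U_{1,\varepsilon}(-x)=U_{1,\varepsilon}(x),\qquad U_{2,\varepsilon}(-x)=-U_{2,\varepsilon}(x),\qquad x\in\mathbb{R}.$$ Moreover, $$\|U_\varepsilon-u_\theta\|_{C^1(\mathbb{R};\mathbb{R}^2)}\to 0\quad\text{as }\varepsilon\to 0,$$ where $u_\theta(x)=\left(\sqrt{1-\theta^2}\cos(\theta x),\sqrt{1-\theta^2}\sin(\theta x)\right)$.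
   Context: Here $u=(u_1,u_2):\mathbb{R}\to\mathbb{R}^2$, $\nabla_u W_\varepsilon$ denotes the gradient of $W_\varepsilon:\mathbb{R}^2\to\mathbb{R}$ with respect to $(u_1,u_2)$, and solutions are classical (twice continuously differentiable). The function $u_\theta$ is, under the identification $\mathbb{R}^2\cong\mathbb{C}$, $u_\theta(x)=\sqrt{1-\theta^2}\,e^{i\theta x}$; it solves the system with $\varepsilon=0$. The norm is $\|v\|_{C^1(\mathbb{R};\mathbb{R}^2)}=\sup_{x\in\mathbb{R}}|v(x)|+\sup_{x\in\mathbb{R}}|v'(x)|$. In the convergence statement, $\theta$ is fixed. *)

(* Defs.v *)
From Stdlib Require Import Reals.
From Coquelicot Require Import Coquelicot.
Open Scope R_scope.

Definition W (eps : R) (u : R * R) : R :=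
  / 4 * (1 - fst u ^ 2 - snd u ^ 2) ^ 2 + eps / 2 * fst u ^ 2 * snd u ^ 2.

Definition gradient (F : R * R -> R) (p : R * R) : R * R :=
  (Derive (fun a => F (a, snd p)) (fst p),
   Derive (fun b => F (fst p, b)) (snd p)).

Definition curve_Derive_n (u : R -> R * R) (n : nat) (x : R) : R * R :=
  (Derive_n (fun t => fst (u t)) n x, Derive_n (fun t => snd (u t)) n x).

Definition C2 (f : R -> R) : Prop :=
  forall x : R, ex_derive f x /\ ex_derive (Derive f) x /\
                continuous (Derive_n f 2) x.

Definition curve_C2 (u : R -> R * R) : Prop :=
  C2 (fun t => fst (u t)) /\ C2 (fun t => snd (u t)).

Definition classical_solution (eps : R) (u : R -> R * R) : Prop :=
  curve_C2 u /\ forall x : R, curve_Derive_n u 2 x = gradient (W eps) (u x).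

Definition periodic (T : R) (u : R -> R * R) : Prop :=
  forall x : R, u (x + T) = u x.

(* On [R * R], [norm] is Coquelicot's product norm, i.e. the Euclidean one.
   The supremum lives in [Rbar], so it is [p_infty] for an unbounded curve. *)
Definition sup_norm (v : R -> R * R) : Rbar :=
  Lub_Rbar (fun r => exists x : R, r = norm (v x)).

(* Meaningful for differentiable curves only, [Derive] being a total
   operator. Both suprema are nonnegative, so [Rbar_plus] never meets an
   indeterminate form. *)
Definition C1_norm (v : R -> R * R) : Rbar :=
  Rbar_plus (sup_norm v) (sup_norm (curve_Derive_n v 1)).

Definition u_circ (theta : R) (x : R) : R * R :=
  (sqrt (1 - theta ^ 2) * cos (theta * x),
   sqrt (1 - theta ^ 2) * sin (theta * x)).

(* Main.v *)
Require Import Defs.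
From Stdlib Require Import Reals Lra Psatz Lia Classical ClassicalEpsilon.
From Coquelicot Require Import Coquelicot.
From mathcomp Require filter.
Open Scope R_scope.

(* Put [L = pi / (2 theta)]. The required symmetries leave a single unknown [w = u_1] on [0, L], with
   [u_2 x = w (L - x)], [w' 0 = 0] and [w L = 0], and the system is the Euler-Lagrange equation of the
   energy [int_0^L w'^2 / 2 + W (w, w (L - .)) / 2].
   Existence, for every [eps] in (0, 1): a minimizing sequence, made nonnegative by a smooth absolute
   value, is equicontinuous; its limit satisfies the equation weakly, hence classically, and is positive
   because the energy of the zero function is not minimal.
   Convergence holds for every positive solution, minimizing or not. Picone's identity against
   [U = sqrt (1 - theta^2) cos (theta x)] yields [int (|u|^2 - (1 - theta^2))^2 <= C eps], so
   [w'' = - theta^2 w + g] with [int |g| <= C sqrt eps]. Variation of constants makes [w] close to a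
   multiple of [U], and the bound on [|u|^2] makes the factor close to 1. *)

(** * Compactness along an ultrafilter *)

(** Existence is wanted for every [eps] in (0, 1), not only for small ones, so it is not sought by
    perturbing the circle; and as no uniqueness is proved, the convergence argument has to accept
    any positive solution. The two halves meet in the record [quarter_solution], whose bound
    [5 / 8 * L + 1] does not depend on [eps]; this is what makes the final constant uniform. The
    equation is nonlocal, [w] being coupled with its own reflection. Whenever linear theory is
    needed, the reflected factor is frozen into a coefficient: Cauchy uniqueness then gives strict
    positivity on [0, L) and a nonzero slope at [L], and Picone's identity applies. The reflection
    is undone by adding Picone's inequality at [x] and at [L - x]: since [U x ^ 2 + U (L - x) ^ 2]
    is constant, the cubic terms add up to a perfect square and only a multiple of [eps] remains.
    The threshold 1/2 for [theta] makes the energy of an explicit trial function, at most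
    [7 / 64 * L], smaller than the energy [L / 8] of zero. *)

Lemma ultrafilter_on_nat :
  exists F : (nat -> Prop) -> Prop,
    ProperFilter F /\ (forall P, eventually P -> F P) /\
    (forall P : nat -> Prop, F P \/ F (fun n => ~ P n)).
Proof.
destruct (@filter.ultraFilterLemma nat (eventually : classical_sets.set_system nat)) as [F [HF HeF]].
  split.
  - intros [N HN]. exact (HN N (le_n N)).
  - split.
    + exists 0%nat; intros; exact I.
    + intros P Q HP HQ. exact (@filter_and _ _ (@filter_filter _ _ eventually_filter) P Q HP HQ).
    + intros P Q HPQ HP. exact (@filter_imp _ _ (@filter_filter _ _ eventually_filter) P Q HPQ HP).
exists F. destruct (filter.ultra_proper) as [F0 [F1 F2 F3]].
split; [|split].
- split.
  (* Coquelicot asks each member of a proper filter to be inhabited, MathComp only that the empty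
     set is not a member. *)
  + intros P HP. apply NNPP. intros Hn. apply F0.
    apply (F3 P); [|exact HP]. intros n Pn. exfalso. apply Hn. now exists n.
  + split.
    * exact F1.
    * intros P Q HP HQ. exact (F2 P Q HP HQ).
    * intros P Q HPQ HP. exact (F3 P Q HPQ HP).
- exact HeF.
- intros P. exact (@filter.in_ultra_setVsetC nat F P HF).
Qed.

(** The limit is the supremum of those [a] that lie below [u n] for all [n] in a set of [F]. By
    [ultra], if [l - e < u n] or [u n < l + e] failed to hold on a set of [F], the opposite
    inequality would, contradicting the choice of [l]. *)
Lemma bounded_ultralimit (F : (nat -> Prop) -> Prop) (HF : ProperFilter F)
  (ultra : forall P : nat -> Prop, F P \/ F (fun n => ~ P n))
  (u : nat -> R) (B : R) (Hu : forall n, Rabs (u n) <= B) :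
  exists l : R, filterlim u F (locally l).
Proof.
destruct (completeness (fun a => F (fun n => a <= u n))) as [l [Hub Hlub]].
- exists B. intros a Ha. destruct (filter_ex _ Ha) as [n Hn].
  generalize (Rle_abs (u n)) (Hu n). lra.
- exists (- B). apply filter_forall. intros n. generalize (Hu n) (Rabs_maj2 (u n)). lra.
- exists l. apply filterlim_locally. intros e.
  assert (H1 : F (fun n => l - e < u n)).
  { destruct (ultra (fun n => l - e < u n)) as [H|H]; [exact H|exfalso].
    assert (l <= l - e); [|destruct e; simpl in *; lra].
    apply Hlub. intros a Ha. apply Rnot_lt_le. intros Hlt.
    destruct (filter_ex _ (filter_and _ _ H Ha)) as [n [Hn1 Hn2]]. lra. }
  assert (H2 : F (fun n => u n < l + e)).
  { destruct (ultra (fun n => u n < l + e)) as [H|H]; [exact H|exfalso].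
    assert (l + e <= l); [|destruct e; simpl in *; lra].
    apply Hub. revert H. apply filter_imp. intros n Hn; lra. }
  generalize (filter_and _ _ H1 H2). apply filter_imp. intros n [h1 h2].
  change (Rabs (u n - l) < e). apply Rabs_def1; lra.
Qed.

(* Arzela-Ascoli, with the ultrafilter in place of a subsequence. *)
Lemma equicontinuous_ultralimit (F : (nat -> Prop) -> Prop) (HF : ProperFilter F)
  (ultra : forall P : nat -> Prop, F P \/ F (fun n => ~ P n))
  (L B : R) (HL : 0 < L) (u : nat -> R -> R)
  (Hleft : forall n x, x <= 0 -> u n x = u n 0)
  (Hright : forall n x, L <= x -> u n x = u n L)
  (Hu : forall n x, Rabs (u n x) <= B)
  (Hequi : forall e, 0 < e -> exists d, 0 < d /\
     forall n x y, Rabs (x - y) < d -> Rabs (u n x - u n y) <= e) :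
  exists v : R -> R, filterlim u F (@locally (fct_UniformSpace R R_UniformSpace) v) /\
    (forall x, continuous v x) /\ (forall x, filterlim (fun n => u n x) F (locally (v x))).
Proof.
assert (Hl : forall x, exists l : R, filterlim (fun n => u n x) F (locally l)).
{ intros x. now apply (bounded_ultralimit F HF ultra _ B). }
set (v := fun x => proj1_sig (constructive_indefinite_description _ (Hl x))).
assert (Hv : forall x, filterlim (fun n => u n x) F (locally (v x))).
{ intros x. exact (proj2_sig (constructive_indefinite_description _ (Hl x))). }
clearbody v.
assert (Hball : forall x (e : R), 0 < e -> F (fun n => Rabs (u n x - v x) < e)).
{ intros x e He. exact (proj1 (filterlim_locally _ _) (Hv x) (mkposreal e He)). }
assert (Hvequi : forall e, 0 < e -> exists d, 0 < d /\
     forall x y, Rabs (x - y) < d -> Rabs (v x - v y) < e).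
{ intros e He. assert (He4 : 0 < e/4) by lra. destruct (Hequi (e/4) He4) as [d [Hd H]]. exists d; split; [exact Hd|].
  intros x y Hxy.
  destruct (filter_ex _ (filter_and _ _ (Hball x (e/4) He4) (Hball y (e/4) He4))) as [n [h1 h2]].
  generalize (H n x y Hxy). revert h1 h2. unfold Rabs.
  repeat destruct Rcase_abs; lra. }
assert (Heq : forall x y, (forall n, u n x = u n y) -> v x = v y).
{ intros x y Hxy. apply (filterlim_locally_unique (F := F) (fun n => u n x)); [apply Hv|].
  generalize (Hv y). apply filterlim_ext. intros n; now rewrite Hxy. }
exists v; split; [|split]; [|intros x|exact Hv].
- apply filterlim_locally. intros [e He]. assert (He4 : 0 < e/4) by lra.
  destruct (Hequi (e/4)) as [d1 [Hd1 H1]]; [lra|].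
  destruct (Hvequi (e/4)) as [d2 [Hd2 H2]]; [lra|].
  set (d := Rmin d1 d2).
  assert (Hd : 0 < d) by now apply Rmin_pos.
  (* A filter is stable under finite intersections only, so closeness is imposed at finitely many
     nodes. With spacing [d / 2], every point of [0, L] is within [d] of a node, and equicontinuity
     does the rest. *)
  assert (Hgrid : forall N : nat, F (fun n => forall k : nat, (k <= N)%nat ->
            Rabs (u n (INR k * (d/2)) - v (INR k * (d/2))) < e/4)).
  { induction N as [|N IH].
    - generalize (Hball (INR 0 * (d/2)) (e/4) He4). apply filter_imp.
      intros n Hn k Hk. replace k with 0%nat by lia. exact Hn.
    - generalize (filter_and _ _ IH (Hball (INR (S N) * (d/2)) (e/4) He4)).
      apply filter_imp. intros n [Hn1 Hn2] k Hk.
      destruct (Nat.eq_dec k (S N)) as [->|Hne]; [exact Hn2|apply Hn1; lia]. }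
  destruct (nfloor_ex (L / (d/2))) as [N [HN1 HN2]].
  { apply Rdiv_le_0_compat; lra. }
  generalize (Hgrid N). apply filter_imp. intros n Hn.
  assert (Hin : forall x, 0 <= x <= L -> Rabs (u n x - v x) < e).
  { intros x Hx. destruct (nfloor_ex (x / (d/2))) as [k [Hk1 Hk2]].
    { apply Rdiv_le_0_compat; lra. }
    assert (Hx1 : INR k * (d/2) <= x).
    { apply Rmult_le_reg_r with (/ (d/2)); [apply Rinv_0_lt_compat; lra|].
      rewrite Rmult_assoc, Rinv_r, Rmult_1_r; [exact Hk1|lra]. }
    assert (Hx2 : x < INR k * (d/2) + d/2).
    { apply Rmult_lt_reg_r with (/ (d/2)); [apply Rinv_0_lt_compat; lra|].
      rewrite Rmult_plus_distr_r, Rmult_assoc, Rinv_r; [unfold Rdiv in *; lra|lra]. }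
    assert (HkN : (k <= N)%nat).
    { apply INR_le. apply Rnot_lt_le. intros Hlt.
      assert (INR N + 1 <= INR k) by (rewrite <- S_INR; apply le_INR; apply INR_lt in Hlt; lia).
      assert (x / (d/2) <= L / (d/2)).
      { apply Rmult_le_compat_r; [left; apply Rinv_0_lt_compat; lra|lra]. }
      lra. }
    assert (Hdist : Rabs (x - INR k * (d/2)) < d) by (apply Rabs_def1; lra).
    generalize (Hn k HkN)
     (H1 n x _ (Rlt_le_trans _ _ _ Hdist (Rmin_l _ _)))
     (H2 x _ (Rlt_le_trans _ _ _ Hdist (Rmin_r _ _))).
    unfold Rabs. repeat destruct Rcase_abs; lra. }
  intros x. change (Rabs (u n x - v x) < e).
  destruct (Rle_dec x 0) as [Hx|Hx].
  { rewrite (Heq x 0) by (intros m; now apply Hleft). rewrite Hleft; [apply Hin|]; lra. }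
  destruct (Rle_dec L x) as [Hx'|Hx'].
  { rewrite (Heq x L) by (intros m; now apply Hright). rewrite Hright; [apply Hin|]; lra. }
  apply Hin; lra.
- apply filterlim_locally. intros [e He]. destruct (Hvequi e He) as [d [Hd H]].
  exists (mkposreal d Hd). intros y Hy. change (Rabs (v y - v x) < e). apply H. exact Hy.
Qed.

(** * Calculus *)

(** [W eps] is symmetric in its arguments, so [force eps a b] and [force eps b a] are the two
    components of its gradient at [(a, b)]. *)
Definition force (eps a b : R) : R := - (1 - a ^ 2 - b ^ 2) * a + eps * a * b ^ 2.

(* Half of [W eps (a, b)], so that its [a]-derivative is half of [force eps a b]. *)
Definition pot (eps a b : R) : R := / 8 * (1 - a ^ 2 - b ^ 2) ^ 2 + eps / 4 * a ^ 2 * b ^ 2.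

Lemma cont_plus (f g : R -> R) (x : R) :
  continuous f x -> continuous g x -> continuous (fun y => f y + g y) x.
Proof. exact (continuous_plus (V := R_NormedModule) f g x). Qed.

Lemma cont_opp (f : R -> R) (x : R) :
  continuous f x -> continuous (fun y => - f y) x.
Proof. exact (continuous_opp (V := R_NormedModule) f x). Qed.

Lemma cont_minus (f g : R -> R) (x : R) :
  continuous f x -> continuous g x -> continuous (fun y => f y - g y) x.
Proof. exact (continuous_minus (V := R_NormedModule) f g x). Qed.

Lemma cont_mult (f g : R -> R) (x : R) :
  continuous f x -> continuous g x -> continuous (fun y => f y * g y) x.
Proof. exact (continuous_mult f g x). Qed.

Lemma cont_pow (f : R -> R) (n : nat) (x : R) :
  continuous f x -> continuous (fun y => f y ^ n) x.
Proof.
intros Hf; induction n as [|n IH]; simpl; [apply continuous_const|now apply cont_mult].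
Qed.

Lemma cont_reflect (f : R -> R) (L x : R) :
  (forall y, continuous f y) -> continuous (fun y => f (L - y)) x.
Proof.
intros Hf. apply (continuous_comp (fun y => L - y) f); [|apply Hf].
apply cont_minus; [apply continuous_const|apply continuous_id].
Qed.

Lemma cont_force (eps : R) (f g : R -> R) (x : R) :
  continuous f x -> continuous g x -> continuous (fun y => force eps (f y) (g y)) x.
Proof.
intros Hf Hg. unfold force. apply cont_plus; apply cont_mult.
- apply cont_opp, cont_minus; [apply cont_minus; [apply continuous_const|]|]; now apply cont_pow.
- exact Hf.
- apply cont_mult; [apply continuous_const|exact Hf].
- now apply cont_pow.
Qed.

Lemma cont_pot (eps : R) (f g : R -> R) (x : R) :
  continuous f x -> continuous g x -> continuous (fun y => pot eps (f y) (g y)) x.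
Proof.
intros Hf Hg. unfold pot. apply cont_plus; apply cont_mult.
- apply continuous_const.
- apply cont_pow, cont_minus; [apply cont_minus; [apply continuous_const|]|]; now apply cont_pow.
- apply cont_mult; [apply continuous_const|now apply cont_pow].
- now apply cont_pow.
Qed.

Ltac cont := intros; try assumption;
  lazymatch goal with
  | |- continuous (fun x => @?f x + @?g x) _ => apply (cont_plus f g); cont
  | |- continuous (fun x => @?f x - @?g x) _ => apply (cont_minus f g); cont
  | |- continuous (fun x => @?f x * @?g x) _ => apply (cont_mult f g); cont
  | |- continuous (fun x => - @?f x) _ => apply (cont_opp f); cont
  | |- continuous (fun x => @?f x ^ ?n) _ => apply (cont_pow f n); cont
  | |- continuous (fun x => force _ (@?f x) (@?g x)) _ => apply (cont_force _ f g); cont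
  | |- continuous (fun x => pot _ (@?f x) (@?g x)) _ => apply (cont_pot _ f g); cont
  | |- continuous (fun x => ?f (?L - x)) _ => apply (cont_reflect f L); cont
  | |- continuous (fun x => x) _ => apply continuous_id
  | |- continuous (fun _ => ?c) _ => apply continuous_const
  | H : forall x, continuous ?f x |- continuous ?f _ => apply H
  | H : forall x, continuous ?f x |- continuous (fun x => ?f x) _ => apply H
  | _ => idtac
  end.

Lemma is_derive_cont (f : R -> R) (x l : R) : is_derive f x l -> continuous f x.
Proof. intros H. apply (ex_derive_continuous f). now exists l. Qed.

Lemma RInt_ex (f : R -> R) (a b : R) : (forall x, continuous f x) -> ex_RInt f a b.
Proof. intros H. apply (ex_RInt_continuous (V := R_CompleteNormedModule)). intros z _. apply H. Qed.

Lemma RInt_plus_cont (f g : R -> R) (a b : R) :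
  (forall x, continuous f x) -> (forall x, continuous g x) ->
  RInt (fun x => f x + g x) a b = RInt f a b + RInt g a b.
Proof. intros Hf Hg. apply (RInt_plus f g); now apply RInt_ex. Qed.

Lemma RInt_minus_cont (f g : R -> R) (a b : R) :
  (forall x, continuous f x) -> (forall x, continuous g x) ->
  RInt (fun x => f x - g x) a b = RInt f a b - RInt g a b.
Proof. intros Hf Hg. apply (RInt_minus f g); now apply RInt_ex. Qed.

Lemma RInt_scal_cont (f : R -> R) (c a b : R) :
  (forall x, continuous f x) -> RInt (fun x => c * f x) a b = c * RInt f a b.
Proof. intros Hf. apply (RInt_scal f a b c). now apply RInt_ex. Qed.

Lemma RInt_const_R (c a b : R) : RInt (fun _ => c) a b = (b - a) * c.
Proof. rewrite RInt_const. reflexivity. Qed.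

Lemma RInt_le_cont (f g : R -> R) (a b : R) : a <= b ->
  (forall x, continuous f x) -> (forall x, continuous g x) ->
  (forall x, a <= x <= b -> f x <= g x) -> RInt f a b <= RInt g a b.
Proof.
intros Hab Hf Hg H. apply RInt_le; try (now apply RInt_ex); [exact Hab|].
intros x Hx. apply H. lra.
Qed.

Lemma RInt_reflect (f : R -> R) (L : R) :
  (forall x, continuous f x) -> RInt (fun x => f (L - x)) 0 L = RInt f 0 L.
Proof.
intros Hf.
assert (H := RInt_comp_lin f (-1) L 0 L (RInt_ex f _ _ Hf)).
replace (-1 * 0 + L) with L in H by ring. replace (-1 * L + L) with 0 in H by ring.
rewrite <- (opp_RInt_swap f) in H by now apply RInt_ex.
rewrite (RInt_ext _ (fun x => -1 * f (L - x))) in H.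
2:{ intros x _. change (scal (-1) (f (-1 * x + L))) with (-1 * f (-1 * x + L)).
    now replace (-1 * x + L) with (L - x) by ring. }
rewrite (RInt_scal_cont (fun x => f (L - x))) in H by (intros; cont).
change (opp (RInt f 0 L)) with (- RInt f 0 L) in H. lra.
Qed.

Lemma RInt_deriv (f df : R -> R) (a b : R) :
  (forall x, is_derive f x (df x)) -> (forall x, continuous df x) ->
  RInt df a b = f b - f a.
Proof. intros H1 H2. apply is_RInt_unique, (is_RInt_derive f df); auto. Qed.

Lemma is_derive_RInt_cont (f : R -> R) (a x : R) : (forall y, continuous f y) ->
  is_derive (fun y => RInt f a y) x (f x).
Proof.
intros Hf. apply (is_derive_RInt f (fun y => RInt f a y) a); [|apply Hf].
apply filter_forall. intros y. apply (RInt_correct f). now apply RInt_ex.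
Qed.

(** The primitive of [f ^ 2] is nondecreasing and vanishes at both ends, so it is constant and its
    derivative is zero inside; the endpoints follow by continuity. *)
Lemma RInt_cont_square_0 (f : R -> R) (L : R) : 0 < L -> (forall x, continuous f x) ->
  RInt (fun x => f x ^ 2) 0 L <= 0 -> forall x, 0 <= x <= L -> f x = 0.
Proof.
intros HL Hf H.
set (I := fun y => RInt (fun x => f x ^ 2) 0 y).
assert (HI : forall y, is_derive I y (f y ^ 2)).
{ intros y. apply (is_derive_RInt_cont (fun x => f x ^ 2)). intros; cont. }
assert (Hin : forall x, 0 < x < L -> f x = 0).
{ intros x Hx.
  assert (Hmono : forall a b, a <= b -> I a <= I b).
  { intros a b Hab. destruct (Req_dec a b) as [->|Hne]; [lra|].
    destruct (MVT_gen I a b (fun y => f y ^ 2)) as [c [_ Hc]].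
    - intros; apply HI.
    - intros y _. apply continuity_pt_filterlim. apply (is_derive_cont I y _ (HI y)).
    - generalize (Rmult_le_pos _ _ (pow2_ge_0 (f c)) (proj1 (Rminus_le_0 a b) Hab)); lra. }
  assert (I0 : forall y, 0 <= y <= L -> I y = 0).
  { intros y Hy. apply Rle_antisym; [apply Rle_trans with (I L); [apply Hmono; lra|exact H]|].
    replace 0 with (I 0) by (unfold I; now rewrite RInt_point). apply Hmono; lra. }
  assert (Hd : is_derive (fun _ : R => 0) x (f x ^ 2)).
  { apply (is_derive_ext_loc I); [|apply HI].
    assert (Hp : 0 < Rmin x (L - x)) by (apply Rmin_pos; lra).
    exists (mkposreal _ Hp). intros y Hy. apply I0.
    assert (Hy' : Rabs (y - x) < Rmin x (L - x)) by exact Hy.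
    apply Rabs_def2 in Hy'. generalize (Rmin_l x (L - x)) (Rmin_r x (L - x)). lra. }
  apply is_derive_unique in Hd. rewrite Derive_const in Hd. apply Rsqr_0_uniq. unfold Rsqr. simpl in Hd. lra. }
intros x Hx.
destruct (Req_dec (f x) 0) as [|Hne]; [assumption|exfalso].
destruct (proj1 (filterlim_locally f (f x)) (Hf x) (mkposreal _ (Rabs_pos_lt _ Hne))) as [d Hd].
(* Moving [x] by [t / 2], at most [L / 4], towards the middle gives an interior point within [d] of
   [x]. *)
set (t := Rmin (d / 2) (L / 2)).
assert (Ht : 0 < t) by (apply Rmin_pos; destruct d; simpl; lra).
assert (Ht1 : t <= d / 2) by apply Rmin_l. assert (Ht2 : t <= L / 2) by apply Rmin_r.
set (y := if Rle_dec x (L / 2) then x + t / 2 else x - t / 2).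
assert (Hy : 0 < y < L /\ Rabs (y - x) < d).
{ destruct d as [d Hdp]; simpl in *.
  unfold y; destruct Rle_dec; (split; [lra|apply Rabs_def1; lra]). }
generalize (Hd y (proj2 Hy)). change (Rabs (f y - f x) < Rabs (f x) -> False).
rewrite (Hin y (proj1 Hy)), Rminus_0_l, Rabs_Ropp. lra.
Qed.

(** * The energy *)

Lemma Rabs_mult_le (x y A C : R) : Rabs x <= A -> Rabs y <= C -> Rabs (x * y) <= A * C.
Proof.
intros Hx Hy. rewrite Rabs_mult. apply Rmult_le_compat; auto using Rabs_pos.
Qed.

Lemma Rabs_plus_le (x y A C : R) : Rabs x <= A -> Rabs y <= C -> Rabs (x + y) <= A + C.
Proof. intros Hx Hy. generalize (Rabs_triang x y). lra. Qed.

Lemma pot_taylor (eps M a b p q t : R) : 0 < eps < 1 ->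
  Rabs a <= M -> Rabs b <= M -> Rabs p <= M -> Rabs q <= M -> Rabs t <= 1 ->
  pot eps (a + t * p) (b + t * q) <=
  pot eps a b + t / 2 * (force eps a b * p + force eps b a * q) + t ^ 2 * (9 * M ^ 4).
Proof.
intros He Ha Hb Hp Hq Ht.
set (m := M ^ 2).
assert (Haa : Rabs (a * a) <= m) by (unfold m; simpl; rewrite Rmult_1_r; now apply Rabs_mult_le).
assert (Hbb : Rabs (b * b) <= m) by (unfold m; simpl; rewrite Rmult_1_r; now apply Rabs_mult_le).
assert (Hpp : Rabs (p * p) <= m) by (unfold m; simpl; rewrite Rmult_1_r; now apply Rabs_mult_le).
assert (Hqq : Rabs (q * q) <= m) by (unfold m; simpl; rewrite Rmult_1_r; now apply Rabs_mult_le).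
assert (Hap : Rabs (a * p) <= m) by (unfold m; simpl; rewrite Rmult_1_r; now apply Rabs_mult_le).
assert (Hbq : Rabs (b * q) <= m) by (unfold m; simpl; rewrite Rmult_1_r; now apply Rabs_mult_le).
assert (Haq : Rabs (a * q) <= m) by (unfold m; simpl; rewrite Rmult_1_r; now apply Rabs_mult_le).
assert (Hbp : Rabs (b * p) <= m) by (unfold m; simpl; rewrite Rmult_1_r; now apply Rabs_mult_le).
assert (Hpq : Rabs (p * q) <= m) by (unfold m; simpl; rewrite Rmult_1_r; now apply Rabs_mult_le).
assert (Htpp : Rabs (t * (p * p + q * q)) <= 1 * (m + m)) by (apply Rabs_mult_le; [|apply Rabs_plus_le]; assumption).
assert (Htpq : Rabs (t * (p * q)) <= 1 * m) by now apply Rabs_mult_le.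
assert (H1 : Rabs ((a * a + b * b) * (p * p + q * q)) <= (m + m) * (m + m)).
{ apply Rabs_mult_le; now apply Rabs_plus_le. }
assert (H2 : Rabs (2 * (a * p + b * q) + t * (p * p + q * q)) <= 6 * m).
{ apply Rabs_le_between in Hap. apply Rabs_le_between in Hbq. apply Rabs_le_between in Htpp.
  apply Rabs_le_between. lra. }
assert (H3 : Rabs (a * q + b * p + t * (p * q)) <= 3 * m).
{ apply Rabs_le_between in Haq. apply Rabs_le_between in Hbp. apply Rabs_le_between in Htpq.
  apply Rabs_le_between. lra. }
assert (H4 := Rabs_mult_le _ _ _ _ H2 H2).
assert (H5 := Rabs_mult_le _ _ _ _ H3 H3).
assert (H6 := Rabs_mult_le _ _ _ _ Hap Hbq).
apply Rabs_le_between in H1. apply Rabs_le_between in H4. apply Rabs_le_between in H5.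
apply Rabs_le_between in H6. apply Rabs_le_between in Hpp. apply Rabs_le_between in Hqq.
set (X2 := (2 * (a * p + b * q) + t * (p * p + q * q)) * (2 * (a * p + b * q) + t * (p * p + q * q))) in *.
set (X3 := (a * q + b * p + t * (p * q)) * (a * q + b * p + t * (p * q))) in *.
assert (Hid : pot eps (a + t * p) (b + t * q) =
  pot eps a b + t / 2 * (force eps a b * p + force eps b a * q) +
  t ^ 2 * (/ 8 * (2 * ((a * a + b * b) * (p * p + q * q)) - 2 * (p * p + q * q) + X2)
           + / 4 * (eps * (2 * (a * p * (b * q)) + X3)))).
{ unfold pot, force, X2, X3. field. }
rewrite Hid. apply Rplus_le_compat_l. apply Rmult_le_compat_l; [apply pow2_ge_0|].
assert (Hpos : 0 <= p * p + q * q) by (generalize (Rle_0_sqr p) (Rle_0_sqr q); unfold Rsqr; lra).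
replace (M ^ 4) with (m * m) by (unfold m; ring).
assert (eps * (2 * (a * p * (b * q)) + X3) <= 1 * (11 * (m * m))).
{ apply Rle_trans with (eps * (11 * (m * m))).
  - apply Rmult_le_compat_l; lra.
  - apply Rmult_le_compat_r; [|lra]. generalize (Rle_0_sqr m). unfold Rsqr. lra. }
generalize (Rle_0_sqr m). unfold Rsqr. intros. lra.
Qed.

Lemma pot_nonneg (eps a b : R) : 0 < eps -> 0 <= pot eps a b.
Proof.
intros He. unfold pot. generalize (pow2_ge_0 (1 - a ^ 2 - b ^ 2)) (pow2_ge_0 (a * b)).
intros h1 h2. replace (eps / 4 * a ^ 2 * b ^ 2) with (eps / 4 * (a * b) ^ 2) by ring.
assert (0 <= eps / 4 * (a * b) ^ 2) by (apply Rmult_le_pos; lra). lra.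
Qed.

(** Only the condition at [L] is imposed: a zero derivative at 0 is the natural boundary condition
    and comes out of the minimization. Functions live on the whole line, which avoids one-sided
    derivatives. *)
Definition admissible (L : R) (v dv : R -> R) : Prop :=
  (forall x, is_derive v x (dv x)) /\ (forall x, continuous dv x) /\ v L = 0.

(** Half the energy on [0, L] of the curve [(v x, v (L - x))]: by reflection both components have
    the same kinetic energy. *)
Definition energy (eps L : R) (v dv : R -> R) : R :=
  RInt (fun x => / 2 * dv x ^ 2 + pot eps (v x) (v (L - x))) 0 L.

Definition first_variation (eps L : R) (v dv phi dphi : R -> R) : R :=
  RInt (fun x => dv x * dphi x + force eps (v x) (v (L - x)) * phi x) 0 L.

Lemma admissible_cont (L : R) (v dv : R -> R) : admissible L v dv -> forall x, continuous v x.
Proof. intros [H _] x. exact (is_derive_cont v x _ (H x)). Qed.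

Lemma energy_taylor (eps L M t : R) (v dv phi dphi : R -> R) : 0 < eps < 1 -> 0 < L ->
  admissible L v dv -> admissible L phi dphi ->
  (forall x, 0 <= x <= L -> Rabs (v x) <= M /\ Rabs (phi x) <= M) -> Rabs t <= 1 ->
  energy eps L (fun x => v x + t * phi x) (fun x => dv x + t * dphi x) <=
  energy eps L v dv + t * first_variation eps L v dv phi dphi
    + t ^ 2 * RInt (fun x => / 2 * dphi x ^ 2 + 9 * M ^ 4) 0 L.
Proof.
intros He HL Hv Hphi HM Ht.
assert (Cv := admissible_cont _ _ _ Hv). assert (Cphi := admissible_cont _ _ _ Hphi).
destruct Hv as [Dv [Cdv _]]. destruct Hphi as [Dphi [Cdphi _]].
(* Varying the reflected slot of [pot] contributes, after reflecting the integral, the same amount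
   as varying the direct one; the two halves add up to the full [force]. *)
assert (Hsym : first_variation eps L v dv phi dphi =
  RInt (fun x => dv x * dphi x) 0 L +
  / 2 * RInt (fun x => force eps (v x) (v (L - x)) * phi x
                       + force eps (v (L - x)) (v x) * phi (L - x)) 0 L).
{ unfold first_variation. rewrite !RInt_plus_cont by cont.
  rewrite <- (RInt_reflect (fun x => force eps (v (L - x)) (v x) * phi (L - x))) by cont.
  rewrite (RInt_ext (fun x => force eps (v (L - (L - x))) (v (L - x)) * phi (L - (L - x)))
                    (fun x => force eps (v x) (v (L - x)) * phi x)).
  - lra.
  - intros x _. now replace (L - (L - x)) with x by ring. }
rewrite Hsym. unfold energy.
rewrite Rmult_plus_distr_l, <- Rmult_assoc.
rewrite <- !RInt_scal_cont by cont.
rewrite <- !RInt_plus_cont by cont.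
apply RInt_le_cont; [lra|cont|cont|].
intros x Hx.
assert (Hx' : 0 <= L - x <= L) by lra.
generalize (pot_taylor eps M (v x) (v (L - x)) (phi x) (phi (L - x)) t He
  (proj1 (HM x Hx)) (proj1 (HM _ Hx')) (proj2 (HM x Hx)) (proj2 (HM _ Hx')) Ht).
intros H.
replace (/ 2 * (dv x + t * dphi x) ^ 2) with
  (/ 2 * dv x ^ 2 + t * (dv x * dphi x) + t ^ 2 * (/ 2 * dphi x ^ 2)) by field.
lra.
Qed.

Lemma admissible_lincomb (L t : R) (v dv phi dphi : R -> R) :
  admissible L v dv -> admissible L phi dphi ->
  admissible L (fun x => v x + t * phi x) (fun x => dv x + t * dphi x).
Proof.
intros [Dv [Cdv v0]] [Dphi [Cdphi phi0]]. split; [|split].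
- intros x. apply (is_derive_plus v (fun x => t * phi x)); [apply Dv|].
  now apply (is_derive_scal phi).
- cont.
- rewrite v0, phi0. ring.
Qed.

(** A function within [d ^ 2] of the infimum is critical up to order [d]: at [t = d] and [t = - d]
    the energy gap and the quadratic term of the expansion are both of order [d ^ 2], and one
    divides by [d]. *)
Lemma first_variation_bound (eps L M m d : R) (v dv phi dphi : R -> R) : 0 < eps < 1 -> 0 < L ->
  admissible L v dv -> admissible L phi dphi ->
  (forall x, 0 <= x <= L -> Rabs (v x) <= M /\ Rabs (phi x) <= M) -> 0 < d <= 1 ->
  (forall w dw, admissible L w dw -> m <= energy eps L w dw) ->
  energy eps L v dv <= m + d ^ 2 ->
  Rabs (first_variation eps L v dv phi dphi) <=
    d * (1 + RInt (fun x => / 2 * dphi x ^ 2 + 9 * M ^ 4) 0 L).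
Proof.
intros He HL Hv Hphi HM Hd Hm Hvm.
assert (H : forall t, Rabs t <= 1 -> 0 <= d ^ 2 + t * first_variation eps L v dv phi dphi
    + t ^ 2 * RInt (fun x => / 2 * dphi x ^ 2 + 9 * M ^ 4) 0 L).
{ intros t Ht. generalize (energy_taylor eps L M t v dv phi dphi He HL Hv Hphi HM Ht)
   (Hm _ _ (admissible_lincomb L t _ _ _ _ Hv Hphi)). lra. }
assert (H1 := H d ltac:(apply Rabs_le_between; lra)).
assert (H2 := H (- d) ltac:(apply Rabs_le_between; lra)).
apply Rabs_le_between. split; apply Rmult_le_reg_l with d; lra.
Qed.

(* Weighted Young inequality [dv <= s dv^2 / 2 + 1 / (2 s)], whence a modulus of continuity
   depending only on the energy. *)
Lemma admissible_modulus (L s x y : R) (v dv : R -> R) : admissible L v dv ->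
  0 <= x <= y -> y <= L -> 0 < s ->
  Rabs (v y - v x) <= s / 2 * RInt (fun z => dv z ^ 2) 0 L + (y - x) / (2 * s).
Proof.
intros [Dv [Cdv _]] Hxy HyL Hs.
assert (Hsub : RInt (fun z => dv z ^ 2) x y <= RInt (fun z => dv z ^ 2) 0 L).
{ rewrite <- (RInt_Chasles (fun z => dv z ^ 2) 0 x L) by (apply RInt_ex; cont).
  rewrite <- (RInt_Chasles (fun z => dv z ^ 2) x y L) by (apply RInt_ex; cont).
  assert (Hp : forall a b, a <= b -> 0 <= RInt (fun z => dv z ^ 2) a b).
  { intros a b Hab. apply RInt_ge_0; [exact Hab|apply RInt_ex; cont|].
    intros z _. apply pow2_ge_0. }
  generalize (Hp 0 x (proj1 Hxy)) (Hp y L HyL). unfold plus; simpl. lra. }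
assert (Hb : Rabs (v y - v x) <= s / 2 * RInt (fun z => dv z ^ 2) x y + (y - x) / (2 * s)).
{ rewrite <- (RInt_deriv v dv x y Dv Cdv).
  replace ((y - x) / (2 * s)) with ((y - x) * (/ (2 * s))) by reflexivity.
  rewrite <- (RInt_const_R (/ (2 * s))). rewrite <- RInt_scal_cont by cont.
  rewrite <- RInt_plus_cont by cont.
  assert (HY : forall z, - (s / 2 * dv z ^ 2 + / (2 * s)) <= dv z <= s / 2 * dv z ^ 2 + / (2 * s)).
  { intros z.
    assert (Hz : forall c, 0 <= s / 2 * (c + / s) ^ 2).
    { intros c. apply Rmult_le_pos; [lra|apply pow2_ge_0]. }
    assert (Hz1 := Hz (dv z)). assert (Hz2 := Hz (- dv z)).
    replace (s / 2 * (dv z + / s) ^ 2) with (s / 2 * dv z ^ 2 + / (2 * s) + dv z) in Hz1 by (field; lra).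
    replace (s / 2 * (- dv z + / s) ^ 2) with (s / 2 * dv z ^ 2 + / (2 * s) - dv z) in Hz2 by (field; lra).
    lra. }
  apply Rabs_le_between. split.
  - rewrite <- (Rmult_1_l (RInt _ _ _)), Ropp_mult_distr_l, <- RInt_scal_cont by cont.
    apply RInt_le_cont; [lra|cont|cont|]. intros z _. generalize (HY z). lra.
  - apply RInt_le_cont; [lra|cont|cont|]. intros z _. apply HY. }
apply Rle_trans with (1 := Hb). apply Rplus_le_compat_r.
apply Rmult_le_compat_l; lra.
Qed.

Lemma energy_kinetic (eps L : R) (v dv : R -> R) : 0 < eps -> 0 < L -> admissible L v dv ->
  RInt (fun z => dv z ^ 2) 0 L + 2 * RInt (fun x => pot eps (v x) (v (L - x))) 0 L
  = 2 * energy eps L v dv /\ 0 <= RInt (fun z => dv z ^ 2) 0 L /\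
  0 <= RInt (fun x => pot eps (v x) (v (L - x))) 0 L.
Proof.
intros He HL Hv. assert (Cv := admissible_cont _ _ _ Hv). destruct Hv as [Dv [Cdv _]].
split; [|split].
- unfold energy. rewrite RInt_plus_cont, RInt_scal_cont by cont. lra.
- apply RInt_ge_0; [lra|apply RInt_ex; cont|]. intros z _. apply pow2_ge_0.
- apply RInt_ge_0; [lra|apply RInt_ex; cont|]. intros z _. now apply pot_nonneg.
Qed.

Lemma admissible_bound (L E : R) (v dv : R -> R) : admissible L v dv ->
  RInt (fun z => dv z ^ 2) 0 L <= E -> forall x, 0 <= x <= L -> Rabs (v x) <= (E + L) / 2.
Proof.
intros Hv HE x Hx.
generalize (admissible_modulus L 1 x L v dv Hv ltac:(lra) ltac:(lra) ltac:(lra)).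
destruct Hv as [_ [_ ->]]. rewrite Rminus_0_l, Rabs_Ropp.
intros H. apply Rle_trans with (1 := H). lra.
Qed.

(** The choice is [w = sqrt (v ^ 2 + d ^ 2) - d]. Subtracting [d] keeps the zero at [L]; the slope
    does not grow, and [w ^ 2] lies between [v ^ 2 - 2 * d * Rabs v] and [v ^ 2], so the potential
    rises by at most [d * M]. *)
Lemma smooth_abs (eps L M d : R) (v dv : R -> R) : 0 < eps < 1 -> 0 < L -> 0 < d ->
  admissible L v dv -> (forall x, 0 <= x <= L -> Rabs (v x) <= M) ->
  exists w dw, admissible L w dw /\ (forall x, 0 <= w x) /\
    energy eps L w dw <= energy eps L v dv + d * (M * L).
Proof.
intros He HL Hd Hv HM. assert (Cv := admissible_cont _ _ _ Hv).
destruct Hv as [Dv [Cdv v0]].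
assert (Hpos : forall x, 0 < v x ^ 2 + d ^ 2).
{ intros x. generalize (pow2_ge_0 (v x)) (pow_lt d 2 Hd). lra. }
set (q := fun x => sqrt (v x ^ 2 + d ^ 2)).
assert (Hq : forall x, d <= q x /\ q x ^ 2 = v x ^ 2 + d ^ 2 /\ Rabs (v x) <= q x).
{ intros x. unfold q. split; [|split].
  - rewrite <- (sqrt_pow2 d) at 1 by lra. apply sqrt_le_1_alt. generalize (pow2_ge_0 (v x)); lra.
  - apply pow2_sqrt. now left.
  - rewrite <- sqrt_Rsqr_abs. apply sqrt_le_1_alt. unfold Rsqr. generalize (pow2_ge_0 d); nra. }
set (w := fun x => q x - d). set (dw := fun x => v x * dv x * / q x).
assert (Cq : forall x, continuous q x).
{ intros x. apply (continuous_comp (fun x => v x ^ 2 + d ^ 2) sqrt); [cont|].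
  apply continuity_pt_filterlim. apply continuity_pt_sqrt. now left. }
assert (Cqi : forall x, continuous (fun y => / q y) x).
{ intros x. apply (continuous_comp q Rinv); [apply Cq|].
  apply continuous_Rinv. generalize (Hq x); lra. }
assert (Dw : forall x, is_derive w x (dw x)).
{ intros x. unfold w, q, dw.
  assert (Hvx := Dv x).
  evar_last.
  - apply (is_derive_minus (fun x => sqrt (v x ^ 2 + d ^ 2)) (fun _ => d)); [|apply is_derive_const].
    apply (is_derive_comp sqrt (fun x => v x ^ 2 + d ^ 2)).
    + apply is_derive_Reals. apply derivable_pt_lim_sqrt. apply Hpos.
    + apply (is_derive_plus (fun x => v x ^ 2) (fun _ => d ^ 2)); [|apply is_derive_const].
      apply (is_derive_pow v 2). exact Hvx.
  - unfold scal, plus, minus, opp, zero; simpl; unfold mult, plus, opp; simpl.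
    change (sqrt (v x * (v x * 1) + d * (d * 1))) with (q x). field. generalize (Hq x); lra. }
assert (Cdw : forall x, continuous dw x) by (unfold dw; cont).
exists w, dw. split; [|split].
- split; [|split]; [exact Dw|exact Cdw|].
  unfold w, q. rewrite v0. replace (0 ^ 2 + d ^ 2) with (d ^ 2) by ring.
  rewrite sqrt_pow2; lra.
- intros x. unfold w. generalize (Hq x); lra.
- assert (Cw : forall x, continuous w x) by (intros x; exact (is_derive_cont _ _ _ (Dw x))).
  unfold energy. replace (d * (M * L)) with ((L - 0) * (d * M)) by ring.
  rewrite <- RInt_const_R, <- RInt_plus_cont by cont.
  apply RInt_le_cont; [lra|cont|cont|]. intros x Hx.
  assert (Hdw : dw x ^ 2 <= dv x ^ 2).
  { unfold dw. destruct (Hq x) as [h1 [h2 h3]].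
    replace ((v x * dv x * / q x) ^ 2) with (dv x ^ 2 * (v x ^ 2 * / (q x ^ 2))) by (field; lra).
    rewrite <- (Rmult_1_r (dv x ^ 2)) at 2. apply Rmult_le_compat_l; [apply pow2_ge_0|].
    rewrite h2. apply Rmult_le_reg_r with (1 := Hpos x).
    rewrite Rmult_assoc, Rinv_l, Rmult_1_r, Rmult_1_l by (generalize (Hpos x); lra).
    generalize (pow2_ge_0 d); lra. }
  assert (Hw : forall y, 0 <= w y ^ 2 /\ v y ^ 2 - 2 * d * Rabs (v y) <= w y ^ 2 <= v y ^ 2).
  { intros y. destruct (Hq y) as [h1 [h2 h3]]. unfold w.
    replace ((q y - d) ^ 2) with (q y ^ 2 - 2 * d * q y + d ^ 2) by ring. rewrite h2.
    assert (q y <= Rabs (v y) + d).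
    { apply Rsqr_incr_0_var; [|generalize (Rabs_pos (v y)); lra].
      unfold Rsqr. replace (q y * q y) with (q y ^ 2) by ring. rewrite h2.
      rewrite <- (pow2_abs (v y)). generalize (Rabs_pos (v y)); nra. }
    split; [|split].
    - replace (v y ^ 2 + d ^ 2 - 2 * d * q y + d ^ 2) with ((q y - d) ^ 2) by (ring_simplify; lra). apply pow2_ge_0.
    - nra.
    - nra. }
  destruct (Hw x) as [hx0 hx]. destruct (Hw (L - x)) as [hy0 hy].
  generalize (HM x Hx) (HM (L - x) ltac:(lra)). intros hMx hMy.
  (* In terms of squares, lowering them by at most [h] and [k] decreases the coupling term and costs
     at most [(h + k) / 4] in the well term. It is used with [h = k = 2 * d * M]. *)
  assert (Hst : forall s t s' t' h k, 0 <= s' <= s -> 0 <= t' <= t -> s - s' <= h -> t - t' <= k ->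
    / 8 * (1 - s' - t') ^ 2 + eps / 4 * s' * t' <=
    / 8 * (1 - s - t) ^ 2 + eps / 4 * s * t + / 4 * (h + k)).
  { intros s t s' t' h k Hs Ht Hh Hk.
    assert (s' * t' <= s * t) by (apply Rmult_le_compat; lra).
    assert (eps / 4 * s' * t' <= eps / 4 * s * t) by (rewrite !Rmult_assoc; apply Rmult_le_compat_l; lra).
    assert (0 <= (s + t - s' - t') * (s + t + s' + t')) by (apply Rmult_le_pos; lra).
    assert ((1 - s' - t') ^ 2 = (1 - s - t) ^ 2 + 2 * (s + t - s' - t') - (s + t - s' - t') * (s + t + s' + t')) by ring.
    lra. }
  unfold pot.
  assert (h := Hst (v x ^ 2) (v (L - x) ^ 2) (w x ^ 2) (w (L - x) ^ 2)
     (2 * d * M) (2 * d * M)).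
  assert (d * Rabs (v x) <= d * M) by (apply Rmult_le_compat_l; lra).
  assert (d * Rabs (v (L - x)) <= d * M) by (apply Rmult_le_compat_l; lra).
  lra.
Qed.

(** * Minimizers *)

Lemma infimum_nonneg (E : R -> Prop) : (exists e, E e) -> (forall e, E e -> 0 <= e) ->
  exists m, (forall e, E e -> m <= e) /\ (forall d, 0 < d -> exists e, E e /\ e < m + d).
Proof.
intros [e0 He0] Hpos.
destruct (completeness (fun x => E (- x))) as [l [Hub Hlub]].
- exists 0. intros x Hx. generalize (Hpos _ Hx). lra.
- exists (- e0). now rewrite Ropp_involutive.
- exists (- l). split.
  + intros e He. assert (- e <= l); [|lra]. apply Hub. now rewrite Ropp_involutive.
  + intros d Hd. apply NNPP. intros Hn.
    assert (l <= l - d); [|lra]. apply Hlub. intros x Hx.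
    apply Rnot_lt_le. intros Hlt. apply Hn. exists (- x). split; [exact Hx|lra].
Qed.

Lemma cos_reflect (theta x : R) : 0 < theta -> cos (theta * (PI / (2 * theta) - x)) = sin (theta * x).
Proof.
intros Ht. rewrite <- cos_shift. f_equal. field. lra.
Qed.

Lemma sin_reflect (theta x : R) : 0 < theta -> sin (theta * (PI / (2 * theta) - x)) = cos (theta * x).
Proof.
intros Ht. rewrite <- sin_shift. f_equal. field. lra.
Qed.

Lemma is_derive_cos_scal (r theta x : R) :
  is_derive (fun x => r * cos (theta * x)) x (- (r * theta * sin (theta * x))).
Proof. auto_derive; [exact I|ring]. Qed.

Lemma is_derive_sin_scal (r theta x : R) :
  is_derive (fun x => r * sin (theta * x)) x (r * theta * cos (theta * x)).
Proof. auto_derive; [exact I|ring]. Qed.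

Lemma circle_test (eps theta : R) : 0 < eps < 1 -> 0 < theta < / 2 ->
  exists v dv, admissible (PI / (2 * theta)) v dv /\
    energy eps (PI / (2 * theta)) v dv <= 7 / 64 * (PI / (2 * theta)).
Proof.
intros He Ht. set (L := PI / (2 * theta)).
assert (HL : 0 < L) by (apply Rdiv_lt_0_compat; generalize PI_RGT_0; lra).
(* With [r ^ 2 = 1 / 2] the kinetic, well and coupling terms are pointwise at most 4/64, 2/64 and
   1/64; the first bound uses [theta < 1 / 2]. The total stays below 8/64, the value of [pot] at
   zero. *)
set (r := sqrt (/ 2)).
assert (Hr : r ^ 2 = / 2) by (apply pow2_sqrt; lra).
set (v := fun x => r * cos (theta * x)). set (dv := fun x => - (r * theta * sin (theta * x))).
assert (Dv : forall x, is_derive v x (dv x)) by (intros; apply is_derive_cos_scal).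
assert (Cv : forall x, continuous v x) by (intros x; exact (is_derive_cont v x _ (Dv x))).
assert (Cdv : forall x, continuous dv x).
{ intros x. apply (ex_derive_continuous dv). unfold dv. auto_derive. exact I. }
exists v, dv. split.
- split; [|split]; [exact Dv|exact Cdv|].
  unfold v. replace (theta * L) with (PI / 2) by (unfold L; field; lra). rewrite cos_PI2. ring.
- unfold energy. replace (7 / 64 * L) with ((L - 0) * (7 / 64)) by field.
  rewrite <- RInt_const_R. apply RInt_le_cont; [lra|cont|cont|].
  intros x _. unfold v, dv, L. rewrite cos_reflect by lra.
  set (s := sin (theta * x)). set (c := cos (theta * x)).
  assert (Hsc : s ^ 2 + c ^ 2 = 1) by (generalize (sin2_cos2 (theta * x)); unfold Rsqr, s, c; lra).
  unfold pot.
  replace (1 - (r * c) ^ 2 - (r * s) ^ 2) with (1 - r ^ 2 * (s ^ 2 + c ^ 2)) by ring.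
  rewrite Hsc.
  replace (/ 2 * (- (r * theta * s)) ^ 2) with (/ 2 * (r ^ 2) * theta ^ 2 * s ^ 2) by ring.
  replace (eps / 4 * (r * c) ^ 2 * (r * s) ^ 2) with (eps / 4 * r ^ 2 * r ^ 2 * (c ^ 2 * s ^ 2)) by ring.
  rewrite Hr.
  assert (0 <= s ^ 2) by apply pow2_ge_0. assert (0 <= c ^ 2) by apply pow2_ge_0.
  assert (theta ^ 2 * s ^ 2 <= / 4 * 1) by (apply Rmult_le_compat; try apply pow2_ge_0; nra).
  assert (c ^ 2 * s ^ 2 <= / 4) by (generalize (pow2_ge_0 (c ^ 2 - s ^ 2)); nra).
  assert (0 <= c ^ 2 * s ^ 2) by (apply Rmult_le_pos; assumption).
  assert (eps * (c ^ 2 * s ^ 2) <= 1 * / 4) by (apply Rmult_le_compat; lra).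
  lra.
Qed.

(** The tolerance is a square so that [first_variation_bound] applies with [d = / (INR n + 1)]. *)
Definition minimizing (eps L : R) (v dv : nat -> R -> R) (m : R) : Prop :=
  (forall w dw, admissible L w dw -> m <= energy eps L w dw) /\
  (forall n, admissible L (v n) (dv n) /\ (forall x, 0 <= v n x) /\
     energy eps L (v n) (dv n) <= m + (/ (INR n + 1)) ^ 2).

Lemma inv_INR_pos (n : nat) : 0 < / (INR n + 1) <= 1.
Proof.
generalize (pos_INR n). intros H. split; [apply Rinv_0_lt_compat; lra|].
rewrite <- Rinv_1. apply Rinv_le_contravar; lra.
Qed.

Lemma minimizing_sequence (eps theta : R) : 0 < eps < 1 -> 0 < theta < / 2 ->
  exists v dv m, minimizing eps (PI / (2 * theta)) v dv m /\ m <= 7 / 64 * (PI / (2 * theta)).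
Proof.
intros He Ht. destruct (circle_test eps theta He Ht) as [v0 [dv0 [Hv0 Ev0]]].
set (L := PI / (2 * theta)) in *.
assert (HL : 0 < L) by (apply Rdiv_lt_0_compat; generalize PI_RGT_0; lra).
destruct (infimum_nonneg (fun e => exists w dw, admissible L w dw /\ e = energy eps L w dw))
  as [m [Hm1 Hm2]].
- exists (energy eps L v0 dv0), v0, dv0. now split.
- intros e [w [dw [Hw ->]]]. generalize (energy_kinetic eps L w dw (proj1 He) HL Hw). lra.
- assert (Hm : forall w dw, admissible L w dw -> m <= energy eps L w dw).
  { intros w dw Hw. apply Hm1. now exists w, dw. }
  assert (H : forall n : nat, exists p : (R -> R) * (R -> R), admissible L (fst p) (snd p) /\
     (forall x, 0 <= fst p x) /\ energy eps L (fst p) (snd p) <= m + (/ (INR n + 1)) ^ 2).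
  { intros n. assert (Hd := inv_INR_pos n). set (d := / (INR n + 1)) in *.
    assert (Hd2 : 0 < d ^ 2) by (apply pow_lt; lra).
    destruct (Hm2 (d ^ 2 / 2)) as [e [[w [dw [Hw ->]]] Hlt]]; [lra|].
    set (M := (RInt (fun z => dw z ^ 2) 0 L + L) / 2).
    assert (HM : 0 < M).
    { unfold M. generalize (energy_kinetic eps L w dw (proj1 He) HL Hw). lra. }
    assert (HML : 0 < M * L) by now apply Rmult_lt_0_compat.
    (* Half of the tolerance [d ^ 2] goes to the approximation of the infimum, half to the
       smoothing, whose parameter is scaled to cost exactly [d ^ 2 / 2]. *)
    destruct (smooth_abs eps L M (d ^ 2 / 2 / (M * L)) w dw He HL) as [w' [dw' [H1 [H2 H3]]]].
    - apply Rdiv_lt_0_compat; lra.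
    - exact Hw.
    - apply (admissible_bound L _ w dw Hw). apply Rle_refl.
    - exists (w', dw'). simpl. split; [exact H1|split; [exact H2|]].
      replace (d ^ 2 / 2 / (M * L) * (M * L)) with (d ^ 2 / 2) in H3 by (field; lra).
      simpl in *. lra. }
  set (p := fun n => proj1_sig (constructive_indefinite_description _ (H n))).
  exists (fun n => fst (p n)), (fun n => snd (p n)), m. split; [split; [exact Hm|]|].
  + intros n. exact (proj2_sig (constructive_indefinite_description _ (H n))).
  + apply Rle_trans with (2 := Ev0). now apply Hm.
Qed.

(** Composing with this projection extends functions by constants outside [0, L], as
    [equicontinuous_ultralimit] requires, without enlarging the modulus of continuity. *)
Definition clamp (L x : R) : R := Rmax 0 (Rmin x L).

Lemma clamp_in (L x : R) : 0 < L -> 0 <= clamp L x <= L.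
Proof.
intros HL. unfold clamp. generalize (Rmin_r x L). intros H.
split; [apply Rmax_l|apply Rmax_lub; lra].
Qed.

Lemma clamp_id (L x : R) : 0 <= x <= L -> clamp L x = x.
Proof. intros H. unfold clamp. rewrite Rmin_left, Rmax_right; lra. Qed.

Lemma clamp_lipschitz (L x y : R) : 0 < L -> Rabs (clamp L x - clamp L y) <= Rabs (x - y).
Proof.
intros HL. unfold clamp.
apply Rmax_case_strong; apply Rmax_case_strong; apply Rmin_case_strong; apply Rmin_case_strong;
  intros; unfold Rabs; repeat (destruct Rcase_abs); lra.
Qed.

Lemma minimizing_limit (eps L m : R) (v dv : nat -> R -> R) : 0 < eps < 1 -> 0 < L ->
  minimizing eps L v dv m -> m <= 7 / 64 * L ->
  exists (F : (nat -> Prop) -> Prop) (u : R -> R),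
    ProperFilter F /\ (forall P, eventually P -> F P) /\
    (forall e, 0 < e -> F (fun n => forall x, 0 <= x <= L -> Rabs (v n x - u x) < e)) /\
    (forall x, continuous u x) /\ (forall x, 0 <= u x) /\
    (forall n x, 0 <= x <= L -> Rabs (v n x) <= 5 / 8 * L + 1) /\
    (forall x, 0 <= x <= L -> u x <= 5 / 8 * L + 1).
Proof.
intros He HL [Hm Hv] Hm7.
(* Twice the energy is at most [2 * (7 / 64 * L + 1)]. Feeding [L / 4 + 2] into [admissible_bound]
   gives the constant [5 / 8 * L + 1], independent of [eps]. *)
assert (HE : forall n, RInt (fun z => dv n z ^ 2) 0 L <= L / 4 + 2).
{ intros n. destruct (Hv n) as [H1 [H2 H3]].
  generalize (energy_kinetic eps L _ _ (proj1 He) HL H1).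
  assert ((/ (INR n + 1)) ^ 2 <= 1).
  { apply Rle_trans with (1 ^ 2); [|right; ring]. apply pow_incr. destruct (inv_INR_pos n). split; [now left|assumption]. }
  lra. }
assert (HB : forall n x, 0 <= x <= L -> Rabs (v n x) <= 5 / 8 * L + 1).
{ intros n x Hx. replace (5 / 8 * L + 1) with ((L / 4 + 2 + L) / 2) by field.
  exact (admissible_bound L _ _ _ (proj1 (Hv n)) (HE n) x Hx). }
destruct ultrafilter_on_nat as [F [HF [HFe ultra]]].
destruct (equicontinuous_ultralimit F HF ultra L (5 / 8 * L + 1) HL (fun n x => v n (clamp L x)))
  as [u [Hu [Cu Hpt]]].
- intros n x Hx. f_equal. unfold clamp. rewrite !Rmin_left, !Rmax_left; lra.
- intros n x Hx. f_equal. unfold clamp. rewrite !Rmin_right; lra.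
- intros n x. apply HB. now apply clamp_in.
(* This weight makes the kinetic term of [admissible_modulus] at most [e / 2]; then [y - x <= e * s]
   makes the other term at most [e / 2] as well. *)
- intros e Hee. set (s := e / (L / 4 + 2)).
  assert (Hs : 0 < s) by (apply Rdiv_lt_0_compat; lra).
  exists (e * s). split; [now apply Rmult_lt_0_compat|].
  assert (Hmod : forall n x y, 0 <= x <= y -> y <= L -> y - x <= e * s -> Rabs (v n y - v n x) <= e).
  { intros n x y H1 H2 H3.
    apply Rle_trans with (1 := admissible_modulus L s x y _ _ (proj1 (Hv n)) H1 H2 Hs).
    assert (s / 2 * RInt (fun z => dv n z ^ 2) 0 L <= s / 2 * (L / 4 + 2)).
    { apply Rmult_le_compat_l; [lra|apply HE]. }
    assert ((y - x) / (2 * s) <= e / 2).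
    { apply Rmult_le_reg_r with (2 * s); [lra|]. unfold Rdiv at 1.
      rewrite Rmult_assoc, Rinv_l by lra. lra. }
    assert (s / 2 * (L / 4 + 2) = e / 2) by (unfold s; field; lra). lra. }
  intros n x y Hxy.
  generalize (clamp_lipschitz L x y HL) (clamp_in L x HL) (clamp_in L y HL). intros H1 H2 H3.
  destruct (Rle_dec (clamp L x) (clamp L y)) as [Hle|Hle].
  + rewrite Rabs_minus_sym. apply Hmod; try lra.
    rewrite Rabs_minus_sym in H1. generalize (Rle_abs (clamp L y - clamp L x)). lra.
  + apply Hmod; try lra. generalize (Rle_abs (clamp L x - clamp L y)). lra.
- assert (Hlim : forall x l h, (forall n, l <= v n (clamp L x) <= h) -> l <= u x <= h).
  { intros x l h H. split.
    - apply (filterlim_le (F := F) (fun _ => l) (fun n => v n (clamp L x)) (Finite l) (Finite (u x))).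
      + apply filter_forall. apply H.
      + apply filterlim_const.
      + apply Hpt.
    - apply (filterlim_le (F := F) (fun n => v n (clamp L x)) (fun _ => h) (Finite (u x)) (Finite h)).
      + apply filter_forall. apply H.
      + apply Hpt.
      + apply filterlim_const. }
  assert (Hbd : forall x, 0 <= u x <= 5 / 8 * L + 1).
  { intros x. apply Hlim. intros n. split; [apply (Hv n)|].
    apply Rle_trans with (1 := Rle_abs _). apply HB. now apply clamp_in. }
  exists F, u. split; [exact HF|split; [exact HFe|split; [|split; [exact Cu|]]]];
    [|split; [apply Hbd|split; [exact HB|intros; apply Hbd]]].
  intros e Hee. generalize (proj1 (filterlim_locally (U := fct_UniformSpace R R_UniformSpace) _ u) Hu (mkposreal e Hee)).
    apply filter_imp. intros n Hn x Hx. generalize (Hn x). rewrite clamp_id by exact Hx. intros H; exact H.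
Qed.

(** * Weak equation, regularity and positivity of the limit *)

Lemma RInt_uniform_limit (F : (nat -> Prop) -> Prop) (HF : ProperFilter F) (L A : R)
  (g : nat -> R -> R) (h : R -> R) : 0 < L ->
  (forall n x, continuous (g n) x) -> (forall x, continuous h x) ->
  (forall e, 0 < e -> F (fun n => forall x, 0 <= x <= L -> Rabs (g n x - h x) <= e)) ->
  (forall e, 0 < e -> F (fun n => Rabs (A + RInt (g n) 0 L) <= e)) ->
  A + RInt h 0 L = 0.
Proof.
intros HL Hg Hh Hgh HA.
assert (Hall : forall e, 0 < e -> Rabs (A + RInt h 0 L) <= e).
{ intros e He.
  assert (He2 : 0 < e / 2) by lra. assert (HeL : 0 < e / 2 / L) by now apply Rdiv_lt_0_compat.
  destruct (filter_ex _ (filter_and _ _ (Hgh _ HeL) (HA _ He2))) as [n [H1 H2]].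
  assert (H3 : Rabs (RInt (g n) 0 L - RInt h 0 L) <= e / 2).
  { assert (Hgn := Hg n). rewrite <- RInt_minus_cont by cont.
    replace (e / 2) with ((L - 0) * (e / 2 / L)) by (field; lra).
    apply abs_RInt_le_const; [lra| |intros; now apply H1].
    apply RInt_ex. intros x. apply cont_minus; [apply Hg|apply Hh]. }
  replace (A + RInt h 0 L) with ((A + RInt (g n) 0 L) - (RInt (g n) 0 L - RInt h 0 L)) by ring.
  apply Rle_trans with (1 := Rabs_triang _ _). rewrite Rabs_Ropp. lra. }
destruct (Req_dec (A + RInt h 0 L) 0) as [|Hne]; [assumption|exfalso].
generalize (Hall (Rabs (A + RInt h 0 L) / 2)) (Rabs_pos_lt _ Hne). lra.
Qed.

Lemma force_lipschitz (eps B d a b a' b' : R) : 0 < eps < 1 ->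
  Rabs a <= B -> Rabs b <= B -> Rabs a' <= B -> Rabs b' <= B ->
  Rabs (a - a') <= d -> Rabs (b - b') <= d ->
  Rabs (force eps a b - force eps a' b') <= (1 + 9 * B ^ 2) * d.
Proof.
intros He Ha Hb Ha' Hb' Hda Hdb.
assert (Hprod : forall x y, Rabs x <= B -> Rabs y <= B -> Rabs (x * y) <= B * B)
  by (intros; now apply Rabs_mult_le).
assert (H1 : Rabs ((a * a + a * a' + a' * a') * (a - a')) <= (B * B + B * B + B * B) * d).
{ apply Rabs_mult_le; [|exact Hda]. repeat apply Rabs_plus_le; now apply Hprod. }
assert (H2 : Rabs ((b * b) * (a - a')) <= (B * B) * d) by (apply Rabs_mult_le; auto).
assert (H3 : Rabs (a' * (b + b') * (b - b')) <= B * (B + B) * d).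
{ apply Rabs_mult_le; [apply Rabs_mult_le; [|apply Rabs_plus_le]|]; assumption. }
assert (H4 : Rabs ((1 + eps) * ((b * b) * (a - a') + a' * (b + b') * (b - b'))) <=
  2 * (B * B * d + B * (B + B) * d)).
{ apply Rabs_mult_le; [rewrite Rabs_pos_eq; lra|now apply Rabs_plus_le]. }
replace (force eps a b - force eps a' b') with
  ((- (a - a') + (a * a + a * a' + a' * a') * (a - a')) +
   (1 + eps) * ((b * b) * (a - a') + a' * (b + b') * (b - b'))) by (unfold force; ring).
replace ((1 + 9 * B ^ 2) * d) with
  ((d + (B * B + B * B + B * B) * d) + 2 * (B * B * d + B * (B + B) * d)) by ring.
apply Rabs_plus_le; [apply Rabs_plus_le|]; try assumption. now rewrite Rabs_Ropp.
Qed.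

Lemma cont_bounded (f : R -> R) (L : R) : 0 < L -> (forall x, continuous f x) ->
  exists M, 0 < M /\ forall x, 0 <= x <= L -> Rabs (f x) <= M.
Proof.
intros HL Hf.
destruct (continuity_ab_maj (fun x => Rabs (f x)) 0 L) as [c [Hc _]]; [lra| |].
- intros x _. apply continuity_pt_filterlim.
  apply (continuous_comp f Rabs); [apply Hf|apply continuous_Rabs].
- exists (Rabs (f c) + 1). split; [generalize (Rabs_pos (f c)); lra|].
  intros x Hx. generalize (Hc x Hx). lra.
Qed.

(** Uniform convergence is available for the minimizing sequence but not for its derivatives, so
    every derivative is moved onto the test function before passing to the limit. *)
Lemma first_variation_by_parts (eps L : R) (v dv phi dphi ddphi : R -> R) :
  admissible L v dv -> admissible L phi dphi -> (forall x, is_derive dphi x (ddphi x)) ->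
  (forall x, continuous ddphi x) ->
  first_variation eps L v dv phi dphi = - (v 0 * dphi 0) +
    RInt (fun x => force eps (v x) (v (L - x)) * phi x - v x * ddphi x) 0 L.
Proof.
intros Hv Hphi Ddphi Cddphi.
assert (Cv := admissible_cont _ _ _ Hv). assert (Cphi := admissible_cont _ _ _ Hphi).
destruct Hv as [Dv [Cdv v0]]. destruct Hphi as [Dphi [Cdphi _]].
assert (H : RInt (fun x => dv x * dphi x + v x * ddphi x) 0 L = v L * dphi L - v 0 * dphi 0).
{ apply (RInt_deriv (fun x => v x * dphi x)); [|cont].
  intros x. apply (is_derive_mult v dphi x (dv x) (ddphi x)); [apply Dv|apply Ddphi|].
  intros; apply Rmult_comm. }
rewrite v0 in H. unfold first_variation.
rewrite RInt_plus_cont in H by cont. rewrite RInt_plus_cont, RInt_minus_cont by cont. lra.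
Qed.

(** The condition [dphi 0 = 0] removes the boundary term of the integration by parts. Since [phi 0]
    stays free, the conclusion also encodes the natural boundary condition at 0. *)
Lemma weak_equation (eps L m : R) (v dv : nat -> R -> R)
  (F : (nat -> Prop) -> Prop) (HF : ProperFilter F) (u : R -> R)
  (phi dphi ddphi : R -> R) : 0 < eps < 1 -> 0 < L ->
  minimizing eps L v dv m -> (forall P, eventually P -> F P) ->
  (forall e, 0 < e -> F (fun n => forall x, 0 <= x <= L -> Rabs (v n x - u x) < e)) ->
  (forall x, continuous u x) ->
  (forall n x, 0 <= x <= L -> Rabs (v n x) <= 5 / 8 * L + 1) ->
  (forall x, 0 <= x <= L -> Rabs (u x) <= 5 / 8 * L + 1) ->
  admissible L phi dphi -> (forall x, is_derive dphi x (ddphi x)) ->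
  (forall x, continuous ddphi x) -> dphi 0 = 0 ->
  RInt (fun x => force eps (u x) (u (L - x)) * phi x - u x * ddphi x) 0 L = 0.
Proof.
intros He HL [Hm Hv] HFe Hu Cu HvB HuB Hphi Ddphi Cddphi dphi0.
assert (Cphi := admissible_cont _ _ _ Hphi).
assert (Cv : forall n x, continuous (v n) x) by (intros n; exact (admissible_cont _ _ _ (proj1 (Hv n)))).
destruct (cont_bounded phi L HL Cphi) as [M1 [HM1 HM1']].
destruct (cont_bounded ddphi L HL Cddphi) as [M2 [HM2 HM2']].
set (B := 5 / 8 * L + 1) in *.
rewrite <- (Rplus_0_l (RInt _ _ _)).
apply (RInt_uniform_limit F HF L 0
  (fun n x => force eps (v n x) (v n (L - x)) * phi x - v n x * ddphi x)); [exact HL| |cont| |].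
- intros n. assert (Cvn := Cv n). cont.
- intros e Hee. set (K := (1 + 9 * B ^ 2) * M1 + M2).
  assert (HB2 : 0 <= B ^ 2) by apply pow2_ge_0.
  assert (HK : 0 < K).
  { unfold K. assert (0 < (1 + 9 * B ^ 2) * M1) by (apply Rmult_lt_0_compat; lra). lra. }
  generalize (Hu (e / K) (Rdiv_lt_0_compat _ _ Hee HK)).
  apply filter_imp. intros n Hn x Hx.
  assert (Hx' : 0 <= L - x <= L) by lra.
  replace (force eps (v n x) (v n (L - x)) * phi x - v n x * ddphi x -
    (force eps (u x) (u (L - x)) * phi x - u x * ddphi x)) with
    ((force eps (v n x) (v n (L - x)) - force eps (u x) (u (L - x))) * phi x +
     (- (v n x - u x)) * ddphi x) by ring.
  replace e with ((1 + 9 * B ^ 2) * (e / K) * M1 + e / K * M2) by (unfold K in *; field; lra).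
  apply Rabs_plus_le; apply Rabs_mult_le; auto.
  + apply force_lipschitz; auto; left; now apply Hn.
  + rewrite Rabs_Ropp. left; now apply Hn.
- intros e Hee.
  set (M := Rmax B M1).
  set (K := 1 + RInt (fun x => / 2 * dphi x ^ 2 + 9 * M ^ 4) 0 L).
  assert (HK : 0 < K).
  { unfold K. assert (0 <= RInt (fun x => / 2 * dphi x ^ 2 + 9 * M ^ 4) 0 L); [|lra].
    destruct Hphi as [_ [Cdphi _]].
    apply RInt_ge_0; [lra|apply RInt_ex; cont|]. intros x _.
    generalize (pow2_ge_0 (dphi x)) (pow2_ge_0 (M ^ 2)). replace ((M ^ 2) ^ 2) with (M ^ 4) by ring. lra. }
  (* The first variation of [v n] is at most [K / (INR n + 1)], hence at most [e] from this index
     on. *)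
  apply HFe. destruct (nfloor_ex (K / e)) as [N [_ HN]].
  { left. now apply Rdiv_lt_0_compat. }
  exists N. intros n Hn.
  assert (H := first_variation_bound eps L M m (/ (INR n + 1)) (v n) (dv n) phi dphi He HL
     (proj1 (Hv n)) Hphi).
  rewrite (first_variation_by_parts eps L _ _ phi dphi ddphi (proj1 (Hv n)) Hphi Ddphi Cddphi) in H.
  rewrite dphi0, Rmult_0_r, Ropp_0 in H.
  eapply Rle_trans.
  + apply H; [|apply inv_INR_pos|exact Hm|apply Hv].
    intros x Hx. split.
    * apply Rle_trans with (2 := Rmax_l _ _). now apply HvB.
    * apply Rle_trans with (2 := Rmax_r _ _). now apply HM1'.
  + fold K. assert (INR N <= INR n) by now apply le_INR.
    assert (Hn1 : 0 < INR n + 1) by (generalize (pos_INR n); lra).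
    apply Rmult_le_reg_l with (INR n + 1); [exact Hn1|].
    rewrite <- Rmult_assoc, Rinv_r, Rmult_1_l by lra.
    replace K with (K / e * e) by (field; lra). apply Rmult_le_compat_r; lra.
Qed.

(** [E x * exp (K * x)] is nondecreasing and [E x * exp (- K * x)] nonincreasing on [0, L]; the
    first spreads the zero to the left of [x0], the second to the right. *)
Lemma gronwall_zero (E dE : R -> R) (K L x0 : R) : 0 <= x0 <= L ->
  (forall x, is_derive E x (dE x)) -> (forall x, 0 <= x <= L -> Rabs (dE x) <= K * E x) ->
  (forall x, 0 <= E x) -> E x0 = 0 -> forall x, 0 <= x <= L -> E x = 0.
Proof.
intros Hx0 DE HE Epos E0 x Hx.
assert (Hmono : forall G dG c, (forall y, is_derive G y (dG y)) ->
  (forall y, 0 <= y <= L -> 0 <= dG y + c * G y) ->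
  forall a b, 0 <= a <= b -> b <= L -> G a * exp (c * a) <= G b * exp (c * b)).
{ intros G dG c DG Hc a b Hab HbL. destruct (Req_dec a b) as [->|Hne]; [lra|].
  assert (D : forall y, is_derive (fun y => G y * exp (c * y)) y ((dG y + c * G y) * exp (c * y))).
  { intros y. evar_last.
    - apply (is_derive_mult G (fun y => exp (c * y)) y (dG y) (c * exp (c * y))).
      + apply DG.
      + auto_derive; [exact I|ring].
      + intros; apply Rmult_comm.
    - unfold plus, mult; simpl. unfold mult; simpl. ring. }
  destruct (MVT_gen (fun y => G y * exp (c * y)) a b (fun y => (dG y + c * G y) * exp (c * y))) as [z [Hz Hz']].
  - intros; apply D.
  - intros y _. apply continuity_pt_filterlim. exact (is_derive_cont _ _ _ (D y)).
  - rewrite Rmin_left, Rmax_right in Hz by lra.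
    assert (0 <= (dG z + c * G z) * exp (c * z) * (b - a)); [|lra].
    apply Rmult_le_pos; [apply Rmult_le_pos; [apply Hc; lra|left; apply exp_pos]|lra]. }
assert (HE' : forall y, 0 <= y <= L -> - (K * E y) <= dE y <= K * E y).
{ intros y Hy. apply Rabs_le_between. now apply HE. }
apply Rle_antisym; [|apply Epos].
destruct (Rle_dec x x0) as [Hle|Hle].
- assert (H : E x * exp (K * x) <= E x0 * exp (K * x0)).
  { apply (Hmono E dE K DE); try lra. intros y Hy. generalize (HE' y Hy). lra. }
  rewrite E0, Rmult_0_l in H. apply Rmult_le_reg_r with (exp (K * x)); [apply exp_pos|lra].
- assert (H : - E x0 * exp (- K * x0) <= - E x * exp (- K * x)).
  { apply (Hmono (fun y => - E y) (fun y => - dE y) (- K)); try lra.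
    - intros y. apply (is_derive_opp E y (dE y)), DE.
    - intros y Hy. generalize (HE' y Hy). lra. }
  rewrite E0, Ropp_0, Rmult_0_l in H. apply Rmult_le_reg_r with (exp (- K * x)); [apply exp_pos|lra].
Qed.

(** Gronwall's argument for [w ^ 2 + w1 ^ 2], whose derivative [2 * (1 + c) * w * w1] is at most
    [1 + C] times itself. *)
Lemma linear_ode_zero (w w1 f c : R -> R) (C L x0 : R) : 0 <= x0 <= L ->
  (forall x, is_derive w x (w1 x)) -> (forall x, is_derive w1 x (f x)) ->
  (forall x, 0 <= x <= L -> f x = c x * w x /\ Rabs (c x) <= C) ->
  w x0 = 0 -> w1 x0 = 0 -> forall x, 0 <= x <= L -> w x = 0.
Proof.
intros Hx0 Dw Dw1 Hf H0 H1 x Hx.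
assert (HE : w x * w x + w1 x * w1 x = 0).
{ apply (gronwall_zero (fun y => w y * w y + w1 y * w1 y)
    (fun y => 2 * (w y * w1 y) + 2 * (w1 y * f y)) (1 + C) L x0 Hx0); [| | |rewrite H0, H1; ring|exact Hx].
  - intros y. evar_last.
    + apply (is_derive_plus (fun y => w y * w y) (fun y => w1 y * w1 y)).
      * apply (is_derive_mult w w y (w1 y) (w1 y)); [apply Dw|apply Dw|intros; apply Rmult_comm].
      * apply (is_derive_mult w1 w1 y (f y) (f y)); [apply Dw1|apply Dw1|intros; apply Rmult_comm].
    + unfold plus, mult; simpl. unfold mult; simpl. ring.
  - intros y Hy. destruct (Hf y Hy) as [-> Hc].
    replace (2 * (w y * w1 y) + 2 * (w1 y * (c y * w y))) with ((1 + c y) * (2 * (w y * w1 y))) by ring.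
    apply Rabs_mult_le.
    + apply Rabs_plus_le; [rewrite Rabs_R1; lra|exact Hc].
    + apply Rabs_le_between. generalize (pow2_ge_0 (w y - w1 y)) (pow2_ge_0 (w y + w1 y)). lra.
  - intros y. generalize (Rle_0_sqr (w y)) (Rle_0_sqr (w1 y)). unfold Rsqr. lra. }
generalize (Rle_0_sqr (w x)) (Rle_0_sqr (w1 x)). unfold Rsqr. intros.
apply Rsqr_0_uniq. unfold Rsqr. lra.
Qed.

(** All that the convergence proof uses of a solution. The derivatives exist on the whole line,
    while the equation is required on [0, L] only. *)
Record quarter_solution (eps L : R) (w w1 f : R -> R) : Prop := {
  qs_w : forall x, is_derive w x (w1 x);
  qs_w1 : forall x, is_derive w1 x (f x);
  qs_f : forall x, continuous f x;
  qs_left : w1 0 = 0;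
  qs_right : w L = 0;
  qs_eq : forall x, 0 <= x <= L -> f x = force eps (w x) (w (L - x));
  qs_pos : forall x, 0 <= x < L -> 0 < w x;
  qs_bound : forall x, 0 <= x <= L -> 0 <= w x <= 5 / 8 * L + 1 }.

(** With the reflected value [b] frozen, the equation is linear in [a] with a bounded coefficient,
    which brings [linear_ode_zero] into play. *)
Lemma force_factor (eps a b B : R) : 0 < eps < 1 -> 0 <= a <= B -> 0 <= b <= B ->
  force eps a b = (- (1 - a ^ 2 - b ^ 2) + eps * b ^ 2) * a /\
  Rabs (- (1 - a ^ 2 - b ^ 2) + eps * b ^ 2) <= 1 + 3 * B ^ 2.
Proof.
intros He Ha Hb. split; [unfold force; ring|].
assert (a ^ 2 <= B ^ 2) by (apply pow_incr; lra). assert (b ^ 2 <= B ^ 2) by (apply pow_incr; lra).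
assert (0 <= a ^ 2) by apply pow2_ge_0. assert (0 <= b ^ 2) by apply pow2_ge_0.
assert (eps * b ^ 2 <= 1 * B ^ 2) by (apply Rmult_le_compat; lra).
assert (0 <= eps * b ^ 2) by (apply Rmult_le_pos; lra).
apply Rabs_le_between. lra.
Qed.

Lemma quarter_existence (eps theta : R) : 0 < eps < 1 -> 0 < theta < / 2 ->
  exists w w1 f, quarter_solution eps (PI / (2 * theta)) w w1 f.
Proof.
intros He Ht. destruct (minimizing_sequence eps theta He Ht) as [v [dv [m [Hmin Hm7]]]].
set (L := PI / (2 * theta)) in *.
assert (HL : 0 < L) by (apply Rdiv_lt_0_compat; generalize PI_RGT_0; lra).
destruct (minimizing_limit eps L m v dv He HL Hmin Hm7) as [F [u [HF [HFe [Hu [Cu [u0 [HvB HuB]]]]]]]].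
set (f := fun x => force eps (u x) (u (L - x))).
assert (Cf : forall x, continuous f x) by (unfold f; cont).
set (w1 := fun x => RInt f 0 x).
assert (Dw1 : forall x, is_derive w1 x (f x)) by (intros; now apply is_derive_RInt_cont).
assert (Cw1 : forall x, continuous w1 x) by (intros x; exact (is_derive_cont _ _ _ (Dw1 x))).
set (w := fun x => RInt w1 L x).
assert (Dw : forall x, is_derive w x (w1 x)) by (intros; now apply is_derive_RInt_cont).
assert (Cw : forall x, continuous w x) by (intros x; exact (is_derive_cont _ _ _ (Dw x))).
assert (w1_0 : w1 0 = 0) by (unfold w1; now rewrite RInt_point).
assert (w_L : w L = 0) by (unfold w; now rewrite RInt_point).
assert (Hwu : forall x, 0 <= x <= L -> w x = u x).
(* [w] is the double primitive of the force of [u] with the wanted boundary conditions. The test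
   function is chosen with second derivative [w - u], so comparing the weak equation for [u] with
   integration by parts for [w] leaves a zero integral of [(w - u) ^ 2]. *)
{ set (h := fun x => w x - u x). assert (Ch : forall x, continuous h x) by (unfold h; cont).
  set (dphi := fun x => RInt h 0 x).
  assert (Ddphi : forall x, is_derive dphi x (h x)) by (intros; now apply is_derive_RInt_cont).
  assert (Cdphi : forall x, continuous dphi x) by (intros x; exact (is_derive_cont _ _ _ (Ddphi x))).
  set (phi := fun x => RInt dphi L x).
  assert (Dphi : forall x, is_derive phi x (dphi x)) by (intros; now apply is_derive_RInt_cont).
  assert (Cphi : forall x, continuous phi x) by (intros x; exact (is_derive_cont _ _ _ (Dphi x))).
  assert (dphi0 : dphi 0 = 0) by (unfold dphi; now rewrite RInt_point).
  assert (phiL : phi L = 0) by (unfold phi; now rewrite RInt_point).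
  assert (Hweak : RInt (fun x => f x * phi x - u x * h x) 0 L = 0).
  { apply (weak_equation eps L m v dv F HF u phi dphi h He HL Hmin HFe Hu Cu HvB); auto.
    - intros x Hx. rewrite Rabs_pos_eq; auto.
    - split; [|split]; assumption. }
  assert (Hparts : RInt (fun x => f x * phi x - w x * h x) 0 L = 0).
  { replace 0 with ((w1 L * phi L - w L * dphi L) - (w1 0 * phi 0 - w 0 * dphi 0)) at 2
      by (rewrite phiL, w_L, w1_0, dphi0; ring).
    apply (RInt_deriv (fun x => w1 x * phi x - w x * dphi x)); [|cont].
    intros x. evar_last.
    - apply (is_derive_minus (fun x => w1 x * phi x) (fun x => w x * dphi x)).
      + apply (is_derive_mult w1 phi x (f x) (dphi x)); [apply Dw1|apply Dphi|intros; apply Rmult_comm].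
      + apply (is_derive_mult w dphi x (w1 x) (h x)); [apply Dw|apply Ddphi|intros; apply Rmult_comm].
    - unfold minus, plus, opp, mult; simpl. unfold mult; simpl. ring. }
  intros x Hx. apply Rminus_diag_uniq. apply (RInt_cont_square_0 h L HL Ch); [|exact Hx].
  apply Req_le. rewrite RInt_minus_cont in Hweak, Hparts by cont.
  rewrite (RInt_ext _ (fun x => w x * h x - u x * h x)) by (intros; unfold h; simpl; ring).
  rewrite RInt_minus_cont by cont. lra. }
assert (Hf : forall x, 0 <= x <= L -> f x = force eps (w x) (w (L - x))).
{ intros x Hx. unfold f. rewrite !Hwu; [reflexivity|lra|lra]. }
assert (Hwb : forall x, 0 <= x <= L -> 0 <= w x <= 5 / 8 * L + 1).
{ intros x Hx. rewrite Hwu by exact Hx. split; auto. }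
assert (Hlin : forall x, 0 <= x <= L -> f x = (- (1 - w x ^ 2 - w (L - x) ^ 2) + eps * w (L - x) ^ 2) * w x
   /\ Rabs (- (1 - w x ^ 2 - w (L - x) ^ 2) + eps * w (L - x) ^ 2) <= 1 + 3 * (5 / 8 * L + 1) ^ 2).
{ intros x Hx. rewrite (Hf x Hx). apply force_factor; [exact He|now apply Hwb|apply Hwb; lra]. }
(* If [w] vanished, some [v n] would be below 1/16 on [0, L], with potential energy at least
   [15 / 128 * L]; but its energy is below [7 / 64 * L + L / 128], the same number. *)
assert (Hnz : ~ forall x, 0 <= x <= L -> w x = 0).
{ intros Hz. destruct Hmin as [Hmin Hv].
  assert (H1 := Hu (/ 16) ltac:(lra)).
  assert (H2 : F (fun n => / (INR n + 1) ^ 2 < L / 128)).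
  { apply HFe. destruct (nfloor_ex (128 / L)) as [N [_ HN]].
    { left. apply Rdiv_lt_0_compat; lra. }
    exists N. intros n Hn. assert (INR N <= INR n) by now apply le_INR.
    assert (0 <= INR n) by apply pos_INR.
    assert (128 / L < (INR n + 1) ^ 2) by (simpl; nra).
    replace (L / 128) with (/ (128 / L)) by (field; lra).
    apply Rinv_lt_contravar; [|assumption].
    apply Rmult_lt_0_compat; [apply Rdiv_lt_0_compat; lra|apply pow_lt; lra]. }
  destruct (filter_ex _ (filter_and _ _ H1 H2)) as [n [Hn1 Hn2]].
  destruct (Hv n) as [Hadm [_ Hen]].
  assert (Cvn := admissible_cont _ _ _ Hadm).
  destruct (energy_kinetic eps L _ _ (proj1 He) HL Hadm) as [E1 [E2 E3]].
  assert (Hpot : 15 / 128 * L <= RInt (fun x => pot eps (v n x) (v n (L - x))) 0 L).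
  { replace (15 / 128 * L) with ((L - 0) * (15 / 128)) by ring. rewrite <- RInt_const_R.
    apply RInt_le_cont; [lra|cont|cont|]. intros x Hx.
    assert (Hsm : forall y, 0 <= y <= L -> v n y ^ 2 <= / 256).
    { intros y Hy. assert (Hy' := Hn1 y Hy). rewrite <- Hwu, Hz, Rminus_0_r in Hy' by exact Hy.
      rewrite <- pow2_abs. replace (/ 256) with ((/ 16) ^ 2) by field.
      apply pow_incr. split; [apply Rabs_pos|lra]. }
    assert (h1 := Hsm x Hx). assert (h2 := Hsm (L - x) ltac:(lra)).
    unfold pot. assert (0 <= eps / 4 * v n x ^ 2 * v n (L - x) ^ 2).
    { apply Rmult_le_pos; [apply Rmult_le_pos; [lra|]|]; apply pow2_ge_0. }
    generalize (pow2_ge_0 (v n x)) (pow2_ge_0 (v n (L - x))). nra. }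
  rewrite pow_inv in Hen. lra. }
assert (Hlz : forall x, 0 <= x <= L -> w x = 0 -> w1 x <> 0).
{ intros x Hx Hwx Hw1x. apply Hnz.
  exact (linear_ode_zero w w1 f _ _ L x Hx Dw Dw1 Hlin Hwx Hw1x). }
exists w, w1, f. split; auto.
intros x Hx. destruct (Hwb x ltac:(lra)) as [Hge _].
(* A zero in [0, L) would be a minimum of [w], so the slope would vanish there too (at 0 by the
   boundary condition), against [Hlz]. *)
destruct (Rle_lt_or_eq_dec _ _ Hge) as [|Heq]; [assumption|exfalso].
apply (Hlz x ltac:(lra) (eq_sym Heq)).
destruct (Req_dec x 0) as [->|Hx0]; [exact w1_0|].
assert (D : derivable_pt_lim w x (w1 x)) by now apply is_derive_Reals.
rewrite <- (derive_pt_eq_0 w x (w1 x) (exist _ _ D) D).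
apply (deriv_minimum w 0 L); try lra.
intros y Hy1 Hy2. rewrite <- Heq. apply Hwb. lra.
Qed.

(** * Extension to the line *)

(** [0, L] is a fundamental domain of the group generated by the reflections about 0 and [L]. Their
    composites are the shifts by [2 * L], whence the induction on intervals of half-width
    [(2 * INR n + 1) * L]. *)
Lemma fold_ind (L : R) (P : R -> Prop) : 0 < L -> (forall x, 0 <= x <= L -> P x) ->
  (forall x, P x -> P (- x)) -> (forall x, P x -> P (2 * L - x)) -> forall x, P x.
Proof.
intros HL H0 Hopp Hrefl.
assert (H : forall n x, - ((2 * INR n + 1) * L) <= x <= (2 * INR n + 1) * L -> P x).
{ induction n as [|n IH]; intros x Hx.
  - simpl in Hx. destruct (Rle_dec 0 x) as [h|h]; [apply H0; lra|].
    rewrite <- (Ropp_involutive x). apply Hopp, H0. lra.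
  - rewrite S_INR in Hx.
    assert (Hp : 0 <= INR n * L) by (apply Rmult_le_pos; [apply pos_INR|lra]).
    destruct (Rle_dec L x) as [h|h]; [|destruct (Rle_dec (- L) x)].
    + replace x with (2 * L - (- (x - 2 * L))) by ring. apply Hrefl, Hopp, IH. lra.
    + apply IH. lra.
    + replace x with (- (2 * L - (x + 2 * L))) by ring. apply Hopp, Hrefl, IH. lra. }
intros x. destruct (nfloor_ex (Rabs x / L)) as [n [_ Hn]].
{ apply Rdiv_le_0_compat; [apply Rabs_pos|exact HL]. }
apply (H n).
assert (Habs : Rabs x <= (2 * INR n + 1) * L).
{ apply Rle_trans with ((INR n + 1) * L).
  - replace (Rabs x) with (Rabs x / L * L) by (field; lra). apply Rmult_le_compat_r; lra.
  - apply Rmult_le_compat_r; [lra|]. generalize (pos_INR n); lra. }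
apply Rabs_le_between in Habs. exact Habs.
Qed.

Lemma cont_Rabs (f : R -> R) (x : R) : continuous f x -> continuous (fun y => Rabs (f y)) x.
Proof. intros H. apply (continuous_comp f Rabs); [exact H|apply continuous_Rabs]. Qed.

(** The triangle wave of period [4 * L]. It folds the line onto [- L, L] compatibly with both
    reflections, so extensions can be written by composition instead of pasting. *)
Definition triangle (theta x : R) : R := asin (sin (theta * x)) / theta.

Lemma triangle_opp (theta x : R) : triangle theta (- x) = - triangle theta x.
Proof.
unfold triangle. rewrite <- Ropp_mult_distr_r, sin_neg, asin_opp. unfold Rdiv. ring.
Qed.

Lemma triangle_reflect (theta x : R) : 0 < theta ->
  triangle theta (2 * (PI / (2 * theta)) - x) = triangle theta x.
Proof.
intros Ht. unfold triangle.
replace (theta * (2 * (PI / (2 * theta)) - x)) with (PI - theta * x) by (field; lra).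
now rewrite sin_PI_x.
Qed.

Lemma triangle_id (theta x : R) : 0 < theta -> - (PI / (2 * theta)) <= x <= PI / (2 * theta) ->
  triangle theta x = x.
Proof.
intros Ht Hx. unfold triangle. rewrite asin_sin; [field; lra|].
replace (PI / 2) with (theta * (PI / (2 * theta))) by (field; lra).
replace (- (theta * (PI / (2 * theta)))) with (theta * - (PI / (2 * theta))) by ring.
replace (- PI / 2) with (theta * - (PI / (2 * theta))) by (field; lra).
split; apply Rmult_le_compat_l; lra.
Qed.

Lemma triangle_cont (theta x : R) : 0 < theta -> continuous (triangle theta) x.
Proof.
intros Ht. set (L := PI / (2 * theta)).
assert (HL : 0 < L) by (apply Rdiv_lt_0_compat; generalize PI_RGT_0; lra).
revert x. apply (fold_ind L); [exact HL| | |].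
(* The ball of radius [L] around a point of [0, L] lies in (- L, 2 L), where this one formula holds
   on both sides of the corner at [L]. *)
- intros x Hx. apply (continuous_ext_loc _ (fun y => L - Rabs (y - L))).
  + exists (mkposreal L HL). intros y Hy. assert (Hy' : Rabs (y - x) < L) by exact Hy.
    apply Rabs_def2 in Hy'. unfold Rabs. destruct Rcase_abs as [h|h].
    * rewrite triangle_id; [apply Rminus_diag_uniq; ring|exact Ht|fold L; lra].
    * rewrite <- triangle_reflect by exact Ht. fold L. rewrite triangle_id; [apply Rminus_diag_uniq; ring|exact Ht|fold L; lra].
  + apply cont_minus; [apply continuous_const|]. apply cont_Rabs.
    apply cont_minus; [apply continuous_id|apply continuous_const].
- intros x Hx. apply (continuous_ext (fun y => - triangle theta (- y))).
  + intros y. rewrite triangle_opp. apply Ropp_involutive.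
  + apply cont_opp. apply (continuous_comp Ropp (triangle theta)).
    * apply cont_opp, continuous_id.
    * now rewrite Ropp_involutive.
- intros x Hx. apply (continuous_ext (fun y => triangle theta (2 * L - y))).
  + intros y. now apply triangle_reflect.
  + apply (continuous_comp (fun y => 2 * L - y) (triangle theta)).
    * apply cont_minus; [apply continuous_const|apply continuous_id].
    * now replace (2 * L - (2 * L - x)) with x by ring.
Qed.

(** It is the second derivative that gets extended: integrating it twice yields a twice continuously
    differentiable function, with no matching conditions to check. *)
Lemma symmetric_extension (theta : R) (f : R -> R) : 0 < theta -> (forall x, continuous f x) ->
  f (PI / (2 * theta)) = 0 ->
  exists g : R -> R, (forall x, continuous g x) /\ (forall x, g (- x) = - g x) /\
    (forall x, g (2 * (PI / (2 * theta)) - x) = g x) /\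
    (forall x, 0 <= x <= PI / (2 * theta) -> g x = f (PI / (2 * theta) - x)).
Proof.
intros Ht Cf fL. set (L := PI / (2 * theta)) in *.
set (T := triangle theta).
(* The arguments contain the positive and negative parts of [T x]. One of them is always zero and
   its term vanishes because [f L = 0]; exchanging them gives oddness. *)
exists (fun x => f (L - (Rabs (T x) + T x) * / 2) - f (L - (Rabs (T x) - T x) * / 2)).
split; [|split; [|split]].
- assert (CT : forall x, continuous T x) by (intros; now apply triangle_cont).
  intros x. apply cont_minus.
  + apply (continuous_comp (fun x => L - (Rabs (T x) + T x) * / 2) f); [|apply Cf].
    apply cont_minus; [apply continuous_const|]. apply cont_mult; [|apply continuous_const].
    apply cont_plus; [apply cont_Rabs|]; apply CT.
  + apply (continuous_comp (fun x => L - (Rabs (T x) - T x) * / 2) f); [|apply Cf].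
    apply cont_minus; [apply continuous_const|]. apply cont_mult; [|apply continuous_const].
    apply cont_minus; [apply cont_Rabs|]; apply CT.
- intros x. unfold T. rewrite triangle_opp, Rabs_Ropp. unfold Rminus at 4. rewrite Ropp_involutive.
  fold (Rabs (triangle theta x) - triangle theta x). ring.
- intros x. unfold T. now rewrite triangle_reflect.
- intros x Hx. unfold T. rewrite triangle_id; [|exact Ht|fold L; lra].
  rewrite Rabs_pos_eq by lra.
  replace (L - (x + x) * / 2) with (L - x) by field.
  replace (L - (x - x) * / 2) with L by field. rewrite fL. ring.
Qed.

Lemma zero_derive_const (g d : R -> R) (a b : R) : (forall x, is_derive g x (d x)) ->
  (forall x, Rmin a b <= x <= Rmax a b -> d x = 0) -> g b = g a.
Proof.
intros Hd H0. destruct (MVT_gen g a b d) as [c [Hc Hc']].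
- intros; apply Hd.
- intros y _. apply continuity_pt_filterlim. exact (is_derive_cont _ _ _ (Hd y)).
- rewrite (H0 c Hc) in Hc'. lra.
Qed.

Lemma zero_second_derive (g g1 g2 : R -> R) (a b : R) : (forall x, is_derive g x (g1 x)) ->
  (forall x, is_derive g1 x (g2 x)) -> (forall x, Rmin a b <= x <= Rmax a b -> g2 x = 0) ->
  g a = 0 -> g1 a = 0 -> g b = 0 /\ g1 b = 0.
Proof.
intros H1 H2 H0 ga g1a.
assert (Hg1 : forall x, Rmin a b <= x <= Rmax a b -> g1 x = 0).
{ intros x Hx. rewrite <- g1a. apply (zero_derive_const g1 g2 a x H2). intros y Hy. apply H0.
  generalize (Rmin_l a b) (Rmin_r a b) (Rmax_l a b) (Rmax_r a b). intros.
  assert (Rmin a b <= Rmin a x) by (apply Rmin_glb; lra).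
  assert (Rmax a x <= Rmax a b) by (apply Rmax_lub; lra). lra. }
split.
- rewrite <- ga. now apply (zero_derive_const g g1 a b H1).
- apply Hg1. split; [apply Rmin_r|apply Rmax_r].
Qed.

Lemma is_derive_opp_arg (f df : R -> R) (x : R) : (forall y, is_derive f y (df y)) ->
  is_derive (fun y => f (- y)) x (- df (- x)).
Proof.
intros Hf. assert (D : is_derive (fun y => - y) x (-1)) by (auto_derive; [exact I|ring]).
evar_last; [exact (is_derive_comp f (fun y => - y) x _ _ (Hf (- x)) D)|].
unfold scal; simpl. unfold mult; simpl. ring.
Qed.

Lemma is_derive_reflect (f df : R -> R) (c x : R) : (forall y, is_derive f y (df y)) ->
  is_derive (fun y => f (c - y)) x (- df (c - x)).
Proof.
intros Hf. assert (D : is_derive (fun y => c - y) x (-1)) by (auto_derive; [exact I|ring]).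
evar_last; [exact (is_derive_comp f (fun y => c - y) x _ _ (Hf (c - x)) D)|].
unfold scal; simpl. unfold mult; simpl. ring.
Qed.

(** [b] is the second component of the curve, and the first is [b (L - x)]; [gs_reflect] then says
    that the first component is even. *)
Record global_solution (eps L : R) (b b1 b2 : R -> R) : Prop := {
  gs_b : forall x, is_derive b x (b1 x);
  gs_b1 : forall x, is_derive b1 x (b2 x);
  gs_b2 : forall x, continuous b2 x;
  gs_opp : forall x, b (- x) = - b x;
  gs_reflect : forall x, b (2 * L - x) = b x;
  gs_eq : forall x, b2 x = force eps (b x) (b (L - x)) }.

Lemma global_extension (eps theta : R) (w w1 f : R -> R) : 0 < theta ->
  quarter_solution eps (PI / (2 * theta)) w w1 f ->
  exists b b1 b2, global_solution eps (PI / (2 * theta)) b b1 b2 /\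
    forall x, 0 <= x <= PI / (2 * theta) ->
      b x = w (PI / (2 * theta) - x) /\ b1 x = - w1 (PI / (2 * theta) - x).
Proof.
intros Ht [Dw Dw1 Cf w10 wL Hf _ _].
assert (HL0 : 0 < PI / (2 * theta)) by (apply Rdiv_lt_0_compat; generalize PI_RGT_0; lra).
assert (fL : f (PI / (2 * theta)) = 0).
{ rewrite Hf by lra. rewrite wL. unfold force. ring. }
destruct (symmetric_extension theta f Ht Cf fL) as [g [Cg [gopp [grefl gL]]]].
set (L := PI / (2 * theta)) in *.
set (b1 := fun x => - w1 L + RInt g 0 x).
assert (Db1 : forall x, is_derive b1 x (g x)).
{ intros x. evar_last.
  - apply (is_derive_plus (fun _ => - w1 L) (fun x => RInt g 0 x)); [apply is_derive_const|].
    now apply is_derive_RInt_cont.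
  - unfold plus, zero; simpl. ring. }
assert (Cb1 : forall x, continuous b1 x) by (intros x; exact (is_derive_cont _ _ _ (Db1 x))).
set (b := fun x => RInt b1 0 x).
assert (Db : forall x, is_derive b x (b1 x)) by (intros; now apply is_derive_RInt_cont).
assert (b0 : b 0 = 0) by (unfold b; now rewrite RInt_point).
assert (b10 : b1 0 = - w1 L) by (unfold b1; rewrite RInt_point; apply Rplus_0_r).
assert (HbL : forall x, 0 <= x <= L -> b x = w (L - x) /\ b1 x = - w1 (L - x)).
{ intros x Hx.
  destruct (zero_second_derive (fun y => b y - w (L - y)) (fun y => b1 y - - w1 (L - y))
     (fun y => g y - - - f (L - y)) 0 x) as [H1 H2].
  - intros y. apply (is_derive_minus b (fun y => w (L - y))); [apply Db|].
    now apply is_derive_reflect.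
  - intros y. apply (is_derive_minus b1 (fun y => - w1 (L - y))); [apply Db1|].
    apply (is_derive_opp (fun y => w1 (L - y))). now apply is_derive_reflect.
  - rewrite Rmin_left, Rmax_right by lra. intros y Hy. rewrite gL by lra. ring.
  - rewrite b0, Rminus_0_r, wL. ring.
  - rewrite b10, Rminus_0_r. ring.
  - lra. }
assert (bopp : forall x, b (- x) = - b x).
{ intros x.
  destruct (zero_second_derive (fun y => b y + b (- y)) (fun y => b1 y + - b1 (- y))
     (fun y => g y + - - g (- y)) 0 x) as [H1 _].
  - intros y. apply (is_derive_plus b (fun y => b (- y))); [apply Db|].
    now apply is_derive_opp_arg.
  - intros y. apply (is_derive_plus b1 (fun y => - b1 (- y))); [apply Db1|].
    apply (is_derive_opp (fun y => b1 (- y))). now apply is_derive_opp_arg.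
  - intros y _. rewrite gopp. ring.
  - rewrite Ropp_0, b0. ring.
  - rewrite Ropp_0. ring.
  - lra. }
(* Both sides have the same second derivative and the same value at the fixed point [L]. Equality of
   the slopes there means [b1 L = 0], which is the condition [w1 0 = 0]. *)
assert (brefl : forall x, b (2 * L - x) = b x).
{ intros x.
  destruct (zero_second_derive (fun y => b y - b (2 * L - y)) (fun y => b1 y - - b1 (2 * L - y))
     (fun y => g y - - - g (2 * L - y)) L x) as [H1 _].
  - intros y. apply (is_derive_minus b (fun y => b (2 * L - y))); [apply Db|].
    now apply is_derive_reflect.
  - intros y. apply (is_derive_minus b1 (fun y => - b1 (2 * L - y))); [apply Db1|].
    apply (is_derive_opp (fun y => b1 (2 * L - y))). now apply is_derive_reflect.
  - intros y _. rewrite grefl. ring.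
  - replace (2 * L - L) with L by ring. ring.
  - replace (2 * L - L) with L by ring. destruct (HbL L) as [_ ->]; [lra|].
    replace (L - L) with 0 by ring. rewrite w10. ring.
  - lra. }
exists b, b1, g. split; [|exact HbL]. split; auto.
(* The equation survives both reflections because [force] is odd in its first argument and even in
   its second. *)
apply (fold_ind L); [exact HL0| | |].
- intros x Hx. destruct (HbL x Hx) as [-> _]. destruct (HbL (L - x)) as [-> _]; [lra|].
  rewrite gL by exact Hx. apply Hf. lra.
- intros x Hx. rewrite gopp, bopp, Hx.
  replace (L - - x) with (2 * L - (L - x)) by ring. rewrite brefl. unfold force. ring.
- intros x Hx. rewrite grefl, brefl, Hx.
  replace (L - (2 * L - x)) with (- (L - x)) by ring. rewrite bopp. unfold force. ring.
Qed.

(** * Translation into the notions of the statement *)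

Lemma C2_intro (f f1 f2 : R -> R) : (forall x, is_derive f x (f1 x)) ->
  (forall x, is_derive f1 x (f2 x)) -> (forall x, continuous f2 x) ->
  C2 f /\ (forall x, Derive f x = f1 x) /\ (forall x, Derive_n f 2 x = f2 x).
Proof.
intros H1 H2 C.
assert (D1 : forall x, Derive f x = f1 x) by (intros; now apply is_derive_unique).
assert (D2 : forall x, is_derive (Derive f) x (f2 x)).
{ intros x. apply (is_derive_ext f1); [intros; now rewrite D1|apply H2]. }
assert (D2' : forall x, Derive_n f 2 x = f2 x) by (intros; now apply is_derive_unique).
split; [|now split].
intros x. split; [now exists (f1 x)|split; [now exists (f2 x)|]].
apply (continuous_ext f2); [intros; now rewrite D2'|apply C].
Qed.

Lemma gradient_W (eps : R) (p : R * R) :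
  gradient (W eps) p = (force eps (fst p) (snd p), force eps (snd p) (fst p)).
Proof.
destruct p as [a b]. unfold gradient, W, force; simpl.
f_equal; apply is_derive_unique; auto_derive; try exact I; field.
Qed.

Lemma global_classical (eps L : R) (b b1 b2 : R -> R) : global_solution eps L b b1 b2 ->
  classical_solution eps (fun x => (b (L - x), b x)) /\
  (forall x, Derive (fun t => b (L - t)) x = - b1 (L - x)) /\ (forall x, Derive b x = b1 x).
Proof.
intros [Db Db1 Cb2 bopp brefl beq].
destruct (C2_intro b b1 b2 Db Db1 Cb2) as [h1 [h2 h3]].
destruct (C2_intro (fun t => b (L - t)) (fun t => - b1 (L - t)) (fun t => - - b2 (L - t))) as [k1 [k2 k3]].
- intros x. now apply is_derive_reflect.
- intros x. apply (is_derive_opp (fun y => b1 (L - y))). now apply is_derive_reflect.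
- cont.
- split; [|now split]. split; [now split|].
  intros x. rewrite gradient_W. unfold curve_Derive_n. cbn [fst snd].
  f_equal.
  + etransitivity; [apply k3|]. rewrite beq. replace (L - (L - x)) with x by ring. ring.
  + etransitivity; [apply h3|]. apply beq.
Qed.

Lemma global_periodic (eps L : R) (b b1 b2 : R -> R) : global_solution eps L b b1 b2 ->
  forall x, b (x + 4 * L) = b x.
Proof.
intros [_ _ _ bopp brefl _] x.
rewrite <- brefl. replace (2 * L - (x + 4 * L)) with (- (2 * L - - x)) by ring.
rewrite bopp, brefl, bopp. ring.
Qed.

(** * Convergence to the circular solution *)

(** Two functions with simple zeros at [L] have bounded quotients near [L]; this controls the Picone
    quotients at the endpoint where both denominators vanish. *)
Lemma linear_comparison (g : R -> R) (L l : R) : is_derive g L l -> g L = 0 -> l <> 0 ->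
  exists d, 0 < d /\ forall y, L - d < y < L ->
    Rabs l / 2 * (L - y) <= Rabs (g y) <= 2 * Rabs l * (L - y).
Proof.
intros Hg gL Hl. assert (Hl' := Rabs_pos_lt _ Hl).
apply is_derive_Reals in Hg.
assert (Hl2 : 0 < Rabs l / 2) by lra.
destruct (Hg _ Hl2) as [d Hd]. exists d. split; [apply cond_pos|].
intros y Hy. assert (Hh : y - L <> 0) by lra.
assert (Hyd : Rabs (y - L) < d) by (apply Rabs_def1; lra).
assert (H := Hd (y - L) Hh Hyd).
replace (L + (y - L)) with y in H by ring. rewrite gL, Rminus_0_r in H.
assert (Hq : Rabs (g y - l * (y - L)) <= Rabs l / 2 * (L - y)).
{ replace (g y - l * (y - L)) with ((g y / (y - L) - l) * (y - L)) by (field; lra).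
  apply Rabs_mult_le; [now left|]. rewrite Rabs_left; lra. }
assert (Hly : Rabs (l * (y - L)) = Rabs l * (L - y)).
{ rewrite Rabs_mult, (Rabs_left (y - L)); lra. }
assert (0 <= Rabs l * (L - y)) by (apply Rmult_le_pos; lra).
split.
- assert (H1 := Rabs_triang (g y) (- (g y - l * (y - L)))).
  replace (g y + - (g y - l * (y - L))) with (l * (y - L)) in H1 by ring.
  rewrite Rabs_Ropp, Hly in H1. lra.
- assert (H1 := Rabs_triang (l * (y - L)) (g y - l * (y - L))).
  replace (l * (y - L) + (g y - l * (y - L))) with (g y) in H1 by ring.
  rewrite Hly in H1. lra.
Qed.

Lemma left_limit_nonneg (H : R -> R) (L d : R) : continuous H L -> 0 < d ->
  (forall y, L - d < y < L -> 0 <= H y) -> 0 <= H L.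
Proof.
intros HC Hd Hpos. apply Rnot_lt_le. intros Hneg.
assert (Hn : 0 < - H L) by lra.
destruct (proj1 (filterlim_locally H (H L)) HC (mkposreal _ Hn)) as [c Hc].
set (t := Rmin c d / 2).
assert (Ht : 0 < t) by (unfold t; generalize (Rmin_pos c d (cond_pos c) Hd); lra).
assert (t < c /\ t < d) by (unfold t in *; generalize (Rmin_l c d) (Rmin_r c d); lra).
assert (Hb : Rabs ((L - t) - L) < c) by (apply Rabs_def1; lra).
assert (H1 : Rabs (H (L - t) - H L) < - H L) by exact (Hc (L - t) Hb).
apply Rabs_def2 in H1. assert (H2 := Hpos (L - t) ltac:(lra)). lra.
Qed.

Lemma pos_derive_le (g dg : R -> R) (a b : R) : a <= b ->
  (forall x, a <= x <= b -> is_derive g x (dg x)) ->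
  (forall x, a <= x <= b -> 0 <= dg x) -> g a <= g b.
Proof.
intros Hab Hd Hp. destruct (MVT_gen g a b dg) as [c [Hc Hc']];
  rewrite ?Rmin_left, ?Rmax_right in * by lra.
- intros x Hx. apply Hd. lra.
- intros x Hx. apply continuity_pt_filterlim. exact (is_derive_cont _ _ _ (Hd x Hx)).
- generalize (Rmult_le_pos _ _ (Hp c Hc) (proj1 (Rminus_le_0 a b) Hab)). lra.
Qed.

Lemma quarter_slope (eps L : R) (w w1 f : R -> R) : 0 < eps < 1 -> 0 < L ->
  quarter_solution eps L w w1 f -> w1 L <> 0.
Proof.
intros He HL [Dw Dw1 Cf w10 wL Hf Hpos Hb] H0.
assert (Hlin : forall x, 0 <= x <= L -> f x = (- (1 - w x ^ 2 - w (L - x) ^ 2) + eps * w (L - x) ^ 2) * w x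
   /\ Rabs (- (1 - w x ^ 2 - w (L - x) ^ 2) + eps * w (L - x) ^ 2) <= 1 + 3 * (5 / 8 * L + 1) ^ 2).
{ intros x Hx. rewrite (Hf x Hx). apply force_factor; [exact He|now apply Hb|apply Hb; lra]. }
assert (H := linear_ode_zero w w1 f _ _ L L ltac:(lra) Dw Dw1 Hlin wL H0 0 ltac:(lra)).
generalize (Hpos 0 ltac:(lra)). lra.
Qed.

(* Picone's identity, as in the Brezis-Oswald uniqueness argument: [w] and [r cos (theta x)] are
   positive solutions of linear equations whose potentials differ by [q]. *)
Lemma picone (theta r : R) (w w1 f q : R -> R) : 0 < theta -> 0 < r ->
  (forall x, is_derive w x (w1 x)) -> (forall x, is_derive w1 x (f x)) ->
  (forall x, continuous q x) ->
  (forall x, 0 <= x <= PI / (2 * theta) -> f x = (q x - theta ^ 2) * w x) ->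
  (forall x, 0 <= x < PI / (2 * theta) -> 0 < w x) ->
  w1 0 = 0 -> w (PI / (2 * theta)) = 0 -> w1 (PI / (2 * theta)) <> 0 ->
  RInt (fun x => q x * (w x ^ 2 - (r * cos (theta * x)) ^ 2)) 0 (PI / (2 * theta)) <= 0.
Proof.
intros Ht Hr Dw Dw1 Cq Hf Hpos w10 wL w1L.
assert (HthL : theta * (PI / (2 * theta)) = PI / 2) by (field; lra).
assert (HL : 0 < PI / (2 * theta)) by (apply Rdiv_lt_0_compat; generalize PI_RGT_0; lra).
set (L := PI / (2 * theta)) in *.
set (U := fun x => r * cos (theta * x)).
set (U1 := fun x => - (r * theta * sin (theta * x))).
assert (DU : forall x, is_derive U x (U1 x)) by (intros; apply is_derive_cos_scal).
assert (DU1 : forall x, is_derive U1 x (- theta ^ 2 * U x)).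
{ intros x. unfold U1, U. auto_derive; [exact I|ring]. }
assert (UL : U L = 0) by (unfold U; rewrite HthL, cos_PI2; ring).
assert (U1L : U1 L <> 0).
{ unfold U1. rewrite HthL, sin_PI2. generalize (Rmult_lt_0_compat _ _ Hr Ht). lra. }
assert (U10 : U1 0 = 0) by (unfold U1; rewrite Rmult_0_r, sin_0; ring).
assert (Upos : forall x, 0 <= x < L -> 0 < U x).
{ intros x Hx. apply Rmult_lt_0_compat; [exact Hr|]. apply cos_gt_0.
  - assert (0 <= theta * x) by (apply Rmult_le_pos; lra). generalize PI_RGT_0; lra.
  - rewrite <- HthL. apply Rmult_lt_compat_l; lra. }
assert (Cw : forall x, continuous w x) by (intros x; exact (is_derive_cont _ _ _ (Dw x))).
assert (Cw1 : forall x, continuous w1 x) by (intros x; exact (is_derive_cont _ _ _ (Dw1 x))).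
assert (CU : forall x, continuous U x) by (intros x; exact (is_derive_cont _ _ _ (DU x))).
assert (CU1 : forall x, continuous U1 x) by (intros x; exact (is_derive_cont _ _ _ (DU1 x))).
change (RInt (fun x => q x * (w x ^ 2 - U x ^ 2)) 0 L <= 0).
set (J := fun y => RInt (fun x => q x * (w x ^ 2 - U x ^ 2)) 0 y).
assert (DJ : forall y, is_derive J y (q y * (w y ^ 2 - U y ^ 2))).
{ intros y. apply (is_derive_RInt_cont (fun x => q x * (w x ^ 2 - U x ^ 2))). cont. }
assert (CJ : forall x, continuous J x) by (intros x; exact (is_derive_cont _ _ _ (DJ x))).
set (V := fun x => w1 x * U x - w x * U1 x).
(* The Wronskian [V] satisfies [V' = q * w * U], so the difference of the two sides has derivative
   [V ^ 2 / U ^ 2 + V ^ 2 / w ^ 2], and it vanishes at 0. *)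
assert (HG : forall y, 0 <= y < L -> J y <= V y * (w y / U y - U y / w y)).
{ intros y Hy.
  assert (H : V 0 * (w 0 / U 0 - U 0 / w 0) - J 0 <= V y * (w y / U y - U y / w y) - J y).
  { apply (pos_derive_le (fun x => V x * (w x / U x - U x / w x) - J x)
      (fun x => V x ^ 2 * (/ U x) ^ 2 + V x ^ 2 * (/ w x) ^ 2)); [lra| |].
    - intros x Hx. assert (Hw := Hpos x ltac:(lra)). assert (HU := Upos x ltac:(lra)).
      evar_last.
      + apply (is_derive_minus (fun x => V x * (w x / U x - U x / w x)) J); [|apply DJ].
        apply (is_derive_mult V (fun x => w x / U x - U x / w x)); [| |intros; apply Rmult_comm].
        * apply (is_derive_minus (fun x => w1 x * U x) (fun x => w x * U1 x)).
          -- apply (is_derive_mult w1 U); [apply Dw1|apply DU|intros; apply Rmult_comm].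
          -- apply (is_derive_mult w U1); [apply Dw|apply DU1|intros; apply Rmult_comm].
        * apply (is_derive_minus (fun x => w x / U x) (fun x => U x / w x)).
          -- apply (is_derive_div w U); [apply Dw|apply DU|lra].
          -- apply (is_derive_div U w); [apply DU|apply Dw|lra].
      + unfold minus, plus, opp, mult; simpl. unfold mult; simpl.
        rewrite Hf by lra. unfold V. field. lra.
    - intros x Hx. apply Rplus_le_le_0_compat; apply Rmult_le_pos; apply pow2_ge_0. }
  replace (V 0) with 0 in H by (unfold V; rewrite w10, U10; ring).
  replace (J 0) with 0 in H by (unfold J; now rewrite RInt_point).
  lra. }
destruct (linear_comparison w L (w1 L) (Dw L) wL w1L) as [d1 [Hd1 H1]].
destruct (linear_comparison U L (U1 L) (DU L) UL U1L) as [d2 [Hd2 H2]].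
set (a := Rabs (w1 L)) in *. set (b := Rabs (U1 L)) in *.
assert (Ha : 0 < a) by now apply Rabs_pos_lt. assert (Hb : 0 < b) by now apply Rabs_pos_lt.
set (K := 4 * (a / b) + 4 * (b / a)).
assert (Hab : 0 < a / b) by now apply Rdiv_lt_0_compat.
assert (Hba : 0 < b / a) by now apply Rdiv_lt_0_compat.
(* [HG] cannot be evaluated at [L]. Near [L] the quotients are at most [4 * (a / b)] and
   [4 * (b / a)], so [K * Rabs (V y)] dominates its right side; this bound is continuous and
   vanishes at [L]. *)
assert (HL0 : 0 <= K * Rabs (V L) - J L).
{ apply (left_limit_nonneg (fun y => K * Rabs (V y) - J y) L (Rmin L (Rmin d1 d2))).
  - apply cont_minus; [|apply CJ]. apply cont_mult; [apply continuous_const|].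
    apply cont_Rabs. unfold V. cont.
  - repeat apply Rmin_pos; assumption.
  - intros y Hy. generalize (Rmin_l L (Rmin d1 d2)) (Rmin_r L (Rmin d1 d2)) (Rmin_l d1 d2) (Rmin_r d1 d2).
    intros. assert (Hy0 : 0 <= y < L) by lra.
    assert (Hw := Hpos y Hy0). assert (HU := Upos y Hy0).
    assert (K1 := H1 y ltac:(lra)). assert (K2 := H2 y ltac:(lra)).
    rewrite Rabs_pos_eq in K1, K2 by lra.
    assert (Hratio : forall c d p s, 0 < c -> 0 < d -> 0 < s ->
      p <= 2 * c * (L - y) -> d / 2 * (L - y) <= s -> p / s <= 4 * (c / d)).
    { intros c d p s Hc Hd Hs Hp1 Hp2. apply Rmult_le_reg_r with s; [exact Hs|].
      unfold Rdiv at 1. rewrite Rmult_assoc, Rinv_l, Rmult_1_r by lra.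
      apply Rle_trans with (1 := Hp1).
      replace (2 * c * (L - y)) with (4 * (c / d) * (d / 2 * (L - y))) by (field; lra).
      apply Rmult_le_compat_l; [|exact Hp2].
      assert (0 < c / d) by now apply Rdiv_lt_0_compat. lra. }
    assert (R1 := Hratio a b (w y) (U y) Ha Hb HU (proj2 K1) (proj1 K2)).
    assert (R2 := Hratio b a (U y) (w y) Hb Ha Hw (proj2 K2) (proj1 K1)).
    assert (0 < w y / U y) by now apply Rdiv_lt_0_compat.
    assert (0 < U y / w y) by now apply Rdiv_lt_0_compat.
    assert (HV : Rabs (V y * (w y / U y - U y / w y)) <= Rabs (V y) * K).
    { apply Rabs_mult_le; [apply Rle_refl|]. apply Rabs_le_between. unfold K. lra. }
    generalize (HG y Hy0) (Rle_abs (V y * (w y / U y - U y / w y))). lra. }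
replace (V L) with 0 in HL0 by (unfold V; rewrite wL, UL; ring).
rewrite Rabs_R0, Rmult_0_r in HL0. change (J L <= 0). lra.
Qed.

Lemma circle_reflect (theta r x : R) : 0 < theta ->
  (r * cos (theta * x)) ^ 2 + (r * cos (theta * (PI / (2 * theta) - x))) ^ 2 = r ^ 2.
Proof.
intros Ht. rewrite cos_reflect by exact Ht. generalize (sin2_cos2 (theta * x)).
unfold Rsqr. intros E. rewrite !Rpow_mult_distr, <- Rmult_plus_distr_l.
replace (cos (theta * x) ^ 2 + sin (theta * x) ^ 2) with 1 by (rewrite <- E; ring). ring.
Qed.

(** Let [D] be the quantity squared in the integral. Picone's weight is [D + eps * w (L - x) ^ 2].
    Adding the inequality to its reflection, and using that [U x ^ 2 + U (L - x) ^ 2 = r ^ 2],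
    produces [D ^ 2] plus terms in [eps] that are at least [- eps * B ^ 2]. *)
Lemma amplitude_estimate (eps theta r : R) (w w1 f : R -> R) : 0 < eps < 1 -> 0 < theta -> 0 < r ->
  r ^ 2 = 1 - theta ^ 2 -> quarter_solution eps (PI / (2 * theta)) w w1 f ->
  RInt (fun x => (w x ^ 2 + w (PI / (2 * theta) - x) ^ 2 - r ^ 2) ^ 2) 0 (PI / (2 * theta)) <=
    eps * ((5 / 8 * (PI / (2 * theta)) + 1) ^ 2 * (PI / (2 * theta))).
Proof.
intros He Ht Hr Hrt Hqs.
assert (HL : 0 < PI / (2 * theta)) by (apply Rdiv_lt_0_compat; generalize PI_RGT_0; lra).
assert (w1L := quarter_slope eps _ w w1 f He HL Hqs).
destruct Hqs as [Dw Dw1 Cf w10 wL Hf Hpos Hb].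
assert (Cw : forall x, continuous w x) by (intros x; exact (is_derive_cont _ _ _ (Dw x))).
set (U := fun x => r * cos (theta * x)).
assert (CU : forall x, continuous U x).
{ intros x. exact (is_derive_cont _ _ _ (is_derive_cos_scal r theta x)). }
assert (HUU : forall x, U x ^ 2 + U (PI / (2 * theta) - x) ^ 2 = r ^ 2)
  by (intros x; now apply circle_reflect).
set (q := fun x => w x ^ 2 + w (PI / (2 * theta) - x) ^ 2 - r ^ 2 + eps * w (PI / (2 * theta) - x) ^ 2).
assert (Cq : forall x, continuous q x) by (unfold q; cont).
assert (HP := picone theta r w w1 f q Ht Hr Dw Dw1 Cq).
set (L := PI / (2 * theta)) in *. set (B := 5 / 8 * L + 1) in *.
assert (HP' : RInt (fun x => q x * (w x ^ 2 - U x ^ 2)) 0 L <= 0).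
{ apply HP; auto. intros x Hx. rewrite Hf by exact Hx. unfold q, force. rewrite Hrt. ring. }
assert (HP2 : RInt (fun x => q (L - x) * (w (L - x) ^ 2 - U (L - x) ^ 2)) 0 L <= 0).
{ apply Rle_trans with (2 := HP'). apply Req_le.
  apply (RInt_reflect (fun x => q x * (w x ^ 2 - U x ^ 2))). cont. }
replace (eps * (B ^ 2 * L)) with ((L - 0) * (eps * B ^ 2)) by ring.
rewrite <- RInt_const_R.
apply Rle_trans with (RInt (fun x => (q x * (w x ^ 2 - U x ^ 2) + q (L - x) * (w (L - x) ^ 2 - U (L - x) ^ 2)) + eps * B ^ 2) 0 L).
- apply RInt_le_cont; [lra|cont|cont|]. intros x Hx.
  unfold q. replace (L - (L - x)) with x by ring.
  assert (E := HUU x).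
  assert (Hb1 : w x ^ 2 <= B ^ 2) by (apply pow_incr; now apply Hb).
  assert (Hb2 : w (L - x) ^ 2 <= B ^ 2) by (apply pow_incr; apply Hb; lra).
  assert (Hr1 : r ^ 2 <= 1) by (generalize (pow2_ge_0 theta); lra).
  assert (P1 := pow2_ge_0 (w x)). assert (P2 := pow2_ge_0 (w (L - x))).
  assert (P3 := pow2_ge_0 (U x)). assert (P4 := pow2_ge_0 (U (L - x))).
  set (s := w x ^ 2) in *. set (t := w (L - x) ^ 2) in *.
  set (p := U x ^ 2) in *. set (p' := U (L - x) ^ 2) in *.
  assert (Hst : t * p + s * p' <= B ^ 2).
  { apply Rle_trans with (B ^ 2 * p + B ^ 2 * p').
    - apply Rplus_le_compat; apply Rmult_le_compat_r; assumption.
    - rewrite <- Rmult_plus_distr_l, E. rewrite <- (Rmult_1_r (B ^ 2)) at 2.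
      apply Rmult_le_compat_l; [apply pow2_ge_0|exact Hr1]. }
  assert (Hst' : eps * (t * p + s * p') <= eps * B ^ 2) by (apply Rmult_le_compat_l; lra).
  assert (0 <= eps * (2 * (s * t))).
  { apply Rmult_le_pos; [lra|]. generalize (Rmult_le_pos _ _ P1 P2). lra. }
  replace (r ^ 2) with (p + p') by exact E. lra.
- rewrite !RInt_plus_cont by cont. lra.
Qed.

(** The multiple of the cosine is chosen so that the difference [z] has zero Cauchy data at 0. Then
    the integrals of the defect against cosine and sine are the coordinates of [(z1, theta * z)] in
    a rotated frame, so an integral bound on the defect yields pointwise bounds. *)
Lemma small_defect (theta r : R) (w w1 f : R -> R) (eta : R) : 0 < theta -> 0 < r ->
  (forall x, is_derive w x (w1 x)) -> (forall x, is_derive w1 x (f x)) ->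
  (forall x, continuous f x) -> w1 0 = 0 ->
  RInt (fun x => Rabs (f x + theta ^ 2 * w x)) 0 (PI / (2 * theta)) <= eta ->
  forall x, 0 <= x <= PI / (2 * theta) ->
    Rabs (w x - w 0 / r * (r * cos (theta * x))) <= 2 * eta / theta /\
    Rabs (w1 x - w 0 / r * (- (r * theta * sin (theta * x)))) <= 2 * eta.
Proof.
intros Ht Hr Dw Dw1 Cf w10 Heta x Hx.
assert (Cw : forall x, continuous w x) by (intros y; exact (is_derive_cont _ _ _ (Dw y))).
set (L := PI / (2 * theta)) in *.
set (g := fun x => f x + theta ^ 2 * w x).
assert (Cg : forall x, continuous g x) by (unfold g; cont).
change (RInt (fun x => Rabs (g x)) 0 L <= eta) in Heta.
assert (Ccos : forall x, continuous (fun x => cos (theta * x)) x).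
{ intros y. apply (ex_derive_continuous (fun x => cos (theta * x))). auto_derive. exact I. }
assert (Csin : forall x, continuous (fun x => sin (theta * x)) x).
{ intros y. apply (ex_derive_continuous (fun x => sin (theta * x))). auto_derive. exact I. }
set (k := w 0 / r). set (z := fun x => w x - k * (r * cos (theta * x))).
set (z1 := fun x => w1 x - k * (- (r * theta * sin (theta * x)))).
change (Rabs (z x) <= 2 * eta / theta /\ Rabs (z1 x) <= 2 * eta).
assert (Dz : forall y, is_derive z y (z1 y)).
{ intros y. apply (is_derive_minus w (fun x => k * (r * cos (theta * x)))); [apply Dw|].
  apply (is_derive_scal (fun x => r * cos (theta * x))), is_derive_cos_scal. }
assert (Dz1 : forall y, is_derive z1 y (g y - theta ^ 2 * z y)).
{ intros y. evar_last.
  - apply (is_derive_minus w1 (fun x => k * (- (r * theta * sin (theta * x))))); [apply Dw1|].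
    auto_derive; [exact I|reflexivity].
  - unfold minus, plus, opp; simpl. unfold g, z. ring. }
assert (Dcos : forall y, is_derive (fun x => cos (theta * x)) y (- (theta * sin (theta * y)))).
{ intros y. auto_derive; [exact I|ring]. }
assert (Dsin : forall y, is_derive (fun x => sin (theta * x)) y (theta * cos (theta * y))).
{ intros y. auto_derive; [exact I|ring]. }
assert (Hint : forall c, (forall y, continuous c y) -> (forall y, Rabs (c y) <= 1) ->
   Rabs (RInt (fun y => g y * c y) 0 x) <= eta).
{ intros c Cc Hc.
  assert (Cag : forall y, continuous (fun y => Rabs (g y)) y) by (intros; now apply cont_Rabs).
  apply Rle_trans with (RInt (fun y => Rabs (g y * c y)) 0 x).
  - apply abs_RInt_le; [lra|]. apply RInt_ex. cont.
  - apply Rle_trans with (RInt (fun y => Rabs (g y)) 0 x).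
    + apply RInt_le_cont; [lra|intros; apply cont_Rabs; cont|exact Cag|].
      intros y _. rewrite Rabs_mult. rewrite <- (Rmult_1_r (Rabs (g y))) at 2.
      apply Rmult_le_compat_l; [apply Rabs_pos|apply Hc].
    + apply Rle_trans with (2 := Heta).
      rewrite <- (RInt_Chasles (fun y => Rabs (g y)) 0 x L) by (now apply RInt_ex).
      assert (0 <= RInt (fun y => Rabs (g y)) x L).
      { apply RInt_ge_0; [lra|now apply RInt_ex|]. intros; apply Rabs_pos. }
      unfold plus; simpl. lra. }
assert (z0 : z 0 = 0) by (unfold z, k; rewrite Rmult_0_r, cos_0; field; lra).
assert (z10 : z1 0 = 0) by (unfold z1; rewrite Rmult_0_r, sin_0, w10; ring).
assert (HA : Rabs (z1 x * cos (theta * x) + theta * (z x * sin (theta * x))) <= eta).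
{ assert (E : RInt (fun y => g y * cos (theta * y)) 0 x =
    (z1 x * cos (theta * x) + theta * (z x * sin (theta * x)))
    - (z1 0 * cos (theta * 0) + theta * (z 0 * sin (theta * 0)))).
  { apply (RInt_deriv (fun y => z1 y * cos (theta * y) + theta * (z y * sin (theta * y)))); [|cont].
    intros y. evar_last.
    - apply (is_derive_plus (fun y => z1 y * cos (theta * y)) (fun y => theta * (z y * sin (theta * y)))).
      + apply (is_derive_mult z1 (fun y => cos (theta * y))); [apply Dz1|apply Dcos|intros; apply Rmult_comm].
      + apply (is_derive_scal (fun y => z y * sin (theta * y))).
        apply (is_derive_mult z (fun y => sin (theta * y))); [apply Dz|apply Dsin|intros; apply Rmult_comm].
    - unfold plus, mult; simpl. unfold mult; simpl. ring. }
  rewrite z0, z10 in E.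
  replace (z1 x * cos (theta * x) + theta * (z x * sin (theta * x))) with (RInt (fun y => g y * cos (theta * y)) 0 x) by lra.
  apply Hint; [exact Ccos|]. intros y. apply Rabs_le_between. generalize (COS_bound (theta * y)). lra. }
assert (HB : Rabs (z1 x * sin (theta * x) - theta * (z x * cos (theta * x))) <= eta).
{ assert (E : RInt (fun y => g y * sin (theta * y)) 0 x =
    (z1 x * sin (theta * x) - theta * (z x * cos (theta * x)))
    - (z1 0 * sin (theta * 0) - theta * (z 0 * cos (theta * 0)))).
  { apply (RInt_deriv (fun y => z1 y * sin (theta * y) - theta * (z y * cos (theta * y)))); [|cont].
    intros y. evar_last.
    - apply (is_derive_minus (fun y => z1 y * sin (theta * y)) (fun y => theta * (z y * cos (theta * y)))).
      + apply (is_derive_mult z1 (fun y => sin (theta * y))); [apply Dz1|apply Dsin|intros; apply Rmult_comm].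
      + apply (is_derive_scal (fun y => z y * cos (theta * y))).
        apply (is_derive_mult z (fun y => cos (theta * y))); [apply Dz|apply Dcos|intros; apply Rmult_comm].
    - unfold minus, opp, plus, mult; simpl. unfold mult; simpl. ring. }
  rewrite z0, z10 in E.
  replace (z1 x * sin (theta * x) - theta * (z x * cos (theta * x))) with (RInt (fun y => g y * sin (theta * y)) 0 x) by lra.
  apply Hint; [exact Csin|]. intros y. apply Rabs_le_between. generalize (SIN_bound (theta * y)). lra. }
set (al := z1 x * cos (theta * x) + theta * (z x * sin (theta * x))) in *.
set (be := z1 x * sin (theta * x) - theta * (z x * cos (theta * x))) in *.
assert (Hc : Rabs (cos (theta * x)) <= 1) by (apply Rabs_le_between; generalize (COS_bound (theta * x)); lra).
assert (Hs : Rabs (sin (theta * x)) <= 1) by (apply Rabs_le_between; generalize (SIN_bound (theta * x)); lra).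
assert (Hcs := sin2_cos2 (theta * x)). unfold Rsqr in Hcs.
assert (Ez1 : z1 x = al * cos (theta * x) + be * sin (theta * x)).
{ unfold al, be. rewrite <- (Rmult_1_r (z1 x)) at 1. rewrite <- Hcs. ring. }
assert (Ez : z x = (al * sin (theta * x) + - be * cos (theta * x)) * / theta).
{ unfold al, be. rewrite <- (Rmult_1_r (z x)) at 1. rewrite <- Hcs. field. lra. }
split.
- rewrite Ez. apply Rabs_mult_le; [|rewrite Rabs_pos_eq; [lra|left; now apply Rinv_0_lt_compat]].
  replace (2 * eta) with (eta * 1 + eta * 1) by ring.
  apply Rabs_plus_le; apply Rabs_mult_le; try assumption. now rewrite Rabs_Ropp.
- rewrite Ez1. replace (2 * eta) with (eta * 1 + eta * 1) by ring.
  apply Rabs_plus_le; apply Rabs_mult_le; assumption.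
Qed.

Lemma quarter_convergence (theta r : R) : 0 < theta -> 0 < r -> r ^ 2 = 1 - theta ^ 2 ->
  exists C, 0 < C /\ forall eps w w1 f, 0 < eps < 1 ->
    quarter_solution eps (PI / (2 * theta)) w w1 f ->
    forall x, 0 <= x <= PI / (2 * theta) ->
      Rabs (w x - r * cos (theta * x)) <= C * sqrt eps /\
      Rabs (w1 x - - (r * theta * sin (theta * x))) <= C * sqrt eps.
Proof.
intros Ht Hr Hrt.
assert (HL : 0 < PI / (2 * theta)) by (apply Rdiv_lt_0_compat; generalize PI_RGT_0; lra).
set (L := PI / (2 * theta)). fold L in HL.
set (B := 5 / 8 * L + 1). assert (HB : 0 < B) by (unfold B; lra).
assert (HB2 : 0 < B ^ 2) by now apply pow_lt.
(* The defect is [w * D + eps * w * w (L - x) ^ 2]; the two summands of [K1] bound the integrals of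
   its two terms, up to the factor [sqrt eps]. *)
set (K1 := B * ((1 + B ^ 2) * L + B ^ 2 * L)).
assert (HK1 : 0 < K1).
{ unfold K1. apply Rmult_lt_0_compat; [exact HB|].
  apply Rplus_lt_0_compat; apply Rmult_lt_0_compat; lra. }
set (K2 := 2 * K1 / theta). assert (HK2 : 0 < K2) by (apply Rdiv_lt_0_compat; lra).
set (K3 := ((1 + B ^ 2) + 4 * B * K2) / r ^ 2).
assert (Hr2 : 0 < r ^ 2) by now apply pow_lt.
assert (HBK : 0 < B * K2) by now apply Rmult_lt_0_compat.
assert (HK3 : 0 < K3) by (apply Rdiv_lt_0_compat; lra).
assert (HrK : 0 < K3 * r) by now apply Rmult_lt_0_compat.
assert (HrtK : 0 < K3 * (r * theta)) by (apply Rmult_lt_0_compat; [|apply Rmult_lt_0_compat]; assumption).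
exists (K2 + 2 * K1 + K3 * r + K3 * (r * theta)). split; [lra|].
intros eps w w1 f He Hqs.
set (s := sqrt eps).
assert (Hs : 0 < s) by (apply sqrt_lt_R0; lra).
assert (Hss : s * s = eps) by (apply sqrt_sqrt; lra).
assert (Hs1 : s < 1).
{ unfold s. rewrite <- sqrt_1. apply sqrt_lt_1_alt. lra. }
assert (Hes : eps <= s) by (generalize (Rmult_le_compat_l s s 1); lra).
assert (HD := amplitude_estimate eps theta r w w1 f He Ht Hr Hrt Hqs). fold L B in HD.
assert (Hqs' := Hqs). destruct Hqs' as [Dw Dw1 Cf w10 wL Hf Hpos Hb].
fold L in wL, Hf, Hpos, Hb. fold B in Hb.
assert (Cw : forall x, continuous w x) by (intros x; exact (is_derive_cont _ _ _ (Dw x))).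
set (D := fun x => w x ^ 2 + w (L - x) ^ 2 - r ^ 2) in *.
assert (CD : forall x, continuous D x) by (unfold D; cont).
assert (CaD : forall x, continuous (fun x => Rabs (D x)) x) by (intros; now apply cont_Rabs).
assert (HD1 : RInt (fun x => Rabs (D x)) 0 L <= s * ((1 + B ^ 2) * L)).
{ (* AM-GM *)
  apply Rle_trans with (RInt (fun x => / (2 * s) * D x ^ 2 + s / 2) 0 L).
  - apply RInt_le_cont; [lra|exact CaD|cont|]. intros x _.
    rewrite <- pow2_abs. set (d := Rabs (D x)).
    assert (0 <= / (2 * s) * (d - s) ^ 2).
    { apply Rmult_le_pos; [left; apply Rinv_0_lt_compat; lra|apply pow2_ge_0]. }
    replace (/ (2 * s) * (d - s) ^ 2) with (/ (2 * s) * d ^ 2 - d + s / 2) in H by (field; lra). lra.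
  - rewrite RInt_plus_cont, RInt_scal_cont, RInt_const_R by cont.
    assert (/ (2 * s) * RInt (fun x => D x ^ 2) 0 L <= / (2 * s) * (eps * (B ^ 2 * L))).
    { apply Rmult_le_compat_l; [left; apply Rinv_0_lt_compat; lra|exact HD]. }
    assert (/ (2 * s) * (eps * (B ^ 2 * L)) = s * (B ^ 2 * L) / 2) by (rewrite <- Hss; field; lra).
    assert (0 < s * (B ^ 2 * L)) by (apply Rmult_lt_0_compat; [|apply Rmult_lt_0_compat]; assumption).
    assert (0 < s * L) by (now apply Rmult_lt_0_compat). lra. }
assert (Heta : RInt (fun x => Rabs (f x + theta ^ 2 * w x)) 0 L <= K1 * s).
{ apply Rle_trans with (RInt (fun x => B * Rabs (D x) + B * (s * B ^ 2)) 0 L).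
  - apply RInt_le_cont; [lra|intros; apply cont_Rabs; cont|cont|]. intros x Hx.
    rewrite (Hf x Hx). replace (force eps (w x) (w (L - x)) + theta ^ 2 * w x) with
      (w x * D x + w x * (eps * w (L - x) ^ 2)).
    2:{ unfold force, D. rewrite Hrt. ring. }
    assert (Hb1 := Hb x Hx). assert (Hb2 := Hb (L - x) ltac:(lra)).
    apply Rabs_plus_le; apply Rabs_mult_le; try (rewrite Rabs_pos_eq; lra).
    + apply Rle_refl.
    + apply Rabs_mult_le; [rewrite Rabs_pos_eq; lra|].
      rewrite Rabs_pos_eq by apply pow2_ge_0. now apply pow_incr.
  - rewrite RInt_plus_cont, RInt_scal_cont, RInt_const_R by cont.
    assert (B * RInt (fun x => Rabs (D x)) 0 L <= B * (s * ((1 + B ^ 2) * L))) by (apply Rmult_le_compat_l; lra).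
    unfold K1. lra. }
assert (HZ := small_defect theta r w w1 f (K1 * s) Ht Hr Dw Dw1 Cf w10 Heta). fold L in HZ.
set (k := w 0 / r) in *.
assert (Hw0 : 0 < w 0 <= B) by (split; [apply Hpos|apply Hb]; lra).
assert (Hk : 0 < k) by (apply Rdiv_lt_0_compat; lra).
set (U := fun x => r * cos (theta * x)).
assert (HUU : forall x, U x ^ 2 + U (L - x) ^ 2 = r ^ 2) by (intros x; now apply circle_reflect).
assert (HkU : forall x, Rabs (k * U x) <= B).
{ intros x. unfold U, k. replace (w 0 / r * (r * cos (theta * x))) with (w 0 * cos (theta * x)) by (field; lra).
  rewrite <- (Rmult_1_r B). apply Rabs_mult_le; [rewrite Rabs_pos_eq; lra|].
  apply Rabs_le_between. generalize (COS_bound (theta * x)). lra. }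
assert (Hz : forall x, 0 <= x <= L -> Rabs (w x - k * U x) <= K2 * s).
{ intros x Hx. replace (K2 * s) with (2 * (K1 * s) / theta) by (unfold K2; field; lra). now apply HZ. }
(* Since [w] is close to [k * U], the sum [w x ^ 2 + w (L - x) ^ 2] is close to [k ^ 2 * r ^ 2], and
   it differs from [r ^ 2] by [D]. As [D] is small only in mean, this is integrated over [0, L];
   [k > 0] then turns [k ^ 2 - 1] into [k - 1]. *)
assert (Hk1 : Rabs (k - 1) <= K3 * s).
{ assert (Hsum : forall x, 0 <= x <= L -> r ^ 2 * Rabs (k ^ 2 - 1) <= Rabs (D x) + s * (4 * B * K2)).
  { intros x Hx. assert (Hx' : 0 <= L - x <= L) by lra.
    rewrite <- (Rabs_pos_eq (r ^ 2)) by lra. rewrite <- Rabs_mult.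
    replace (r ^ 2 * (k ^ 2 - 1)) with
      (D x + ((- (w x - k * U x)) * (w x + k * U x) + (- (w (L - x) - k * U (L - x))) * (w (L - x) + k * U (L - x)))).
    2:{ unfold D. replace (r ^ 2 * (k ^ 2 - 1)) with (k ^ 2 * r ^ 2 - r ^ 2) by ring.
        rewrite <- (HUU x). ring. }
    replace (s * (4 * B * K2)) with (K2 * s * (B + B) + K2 * s * (B + B)) by ring.
    apply Rabs_plus_le; [apply Rle_refl|].
    apply Rabs_plus_le; apply Rabs_mult_le; try (rewrite Rabs_Ropp; now apply Hz);
      (apply Rabs_plus_le; [|apply HkU]); rewrite Rabs_pos_eq; apply Hb; assumption. }
  assert (HI : L * (r ^ 2 * Rabs (k ^ 2 - 1)) <= L * (s * ((1 + B ^ 2) + 4 * B * K2))).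
  { replace (L * (r ^ 2 * Rabs (k ^ 2 - 1))) with ((L - 0) * (r ^ 2 * Rabs (k ^ 2 - 1))) by ring.
    rewrite <- RInt_const_R.
    apply Rle_trans with (RInt (fun x => Rabs (D x) + s * (4 * B * K2)) 0 L).
    - apply RInt_le_cont; [lra|cont|cont|exact Hsum].
    - rewrite RInt_plus_cont, RInt_const_R by cont. lra. }
  apply Rmult_le_reg_l in HI; [|exact HL].
  apply Rle_trans with (Rabs (k ^ 2 - 1)).
  - replace (k ^ 2 - 1) with ((k - 1) * (k + 1)) by ring. rewrite Rabs_mult, (Rabs_pos_eq (k + 1)) by lra.
    rewrite <- (Rmult_1_r (Rabs (k - 1))) at 1. apply Rmult_le_compat_l; [apply Rabs_pos|lra].
  - apply Rmult_le_reg_l with (r ^ 2); [exact Hr2|]. apply Rle_trans with (1 := HI).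
    apply Req_le. unfold K3. field. lra. }
intros x Hx. destruct (HZ x Hx) as [Z0 Z1].
assert (Hc : Rabs (cos (theta * x)) <= 1) by (apply Rabs_le_between; generalize (COS_bound (theta * x)); lra).
assert (Hsn : Rabs (- sin (theta * x)) <= 1).
{ rewrite Rabs_Ropp. apply Rabs_le_between; generalize (SIN_bound (theta * x)); lra. }
assert (0 < K2 * s) by (apply Rmult_lt_0_compat; assumption).
assert (0 < K1 * s) by (apply Rmult_lt_0_compat; assumption).
assert (0 < K3 * r * s) by (apply Rmult_lt_0_compat; assumption).
assert (0 < K3 * (r * theta) * s) by (apply Rmult_lt_0_compat; assumption).
split.
- replace (w x - r * cos (theta * x)) with ((w x - k * U x) + (k - 1) * r * cos (theta * x)) by (unfold U; ring).
  apply Rle_trans with (K2 * s + K3 * s * r * 1); [|lra].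
  apply Rabs_plus_le; [now apply Hz|].
  apply Rabs_mult_le; [apply Rabs_mult_le; [exact Hk1|rewrite Rabs_pos_eq; lra]|exact Hc].
- replace (w1 x - - (r * theta * sin (theta * x))) with
    ((w1 x - k * (- (r * theta * sin (theta * x)))) + (k - 1) * (r * theta) * (- sin (theta * x))) by ring.
  apply Rle_trans with (2 * (K1 * s) + K3 * s * (r * theta) * 1); [|lra].
  apply Rabs_plus_le; [exact Z1|].
  apply Rabs_mult_le; [apply Rabs_mult_le; [exact Hk1|]|exact Hsn].
  rewrite Rabs_pos_eq; [apply Rle_refl|]. apply Rmult_le_pos; lra.
Qed.

(** [b] and [r * sin (theta * x)] share both reflection symmetries, so the estimate on [0, L]
    spreads by [fold_ind] with the same constant. *)
Lemma global_convergence (eps theta r M : R) (b b1 b2 w w1 : R -> R) : 0 < theta ->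
  global_solution eps (PI / (2 * theta)) b b1 b2 ->
  (forall x, 0 <= x <= PI / (2 * theta) ->
      b x = w (PI / (2 * theta) - x) /\ b1 x = - w1 (PI / (2 * theta) - x)) ->
  (forall x, 0 <= x <= PI / (2 * theta) ->
      Rabs (w x - r * cos (theta * x)) <= M /\
      Rabs (w1 x - - (r * theta * sin (theta * x))) <= M) ->
  forall x, Rabs (b x - r * sin (theta * x)) <= M /\ Rabs (b1 x - r * theta * cos (theta * x)) <= M.
Proof.
intros Ht [Db Db1 _ bopp brefl _] HbL Hw.
assert (HL : 0 < PI / (2 * theta)) by (apply Rdiv_lt_0_compat; generalize PI_RGT_0; lra).
assert (b1opp : forall x, b1 (- x) = b1 x).
{ intros x. apply Ropp_eq_reg.
  assert (H1 := is_derive_opp_arg b b1 x Db).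
  assert (H2 : is_derive (fun y => b (- y)) x (- b1 x)).
  { apply (is_derive_ext (fun y => - b y)); [intros; now rewrite bopp|].
    apply (is_derive_opp b), Db. }
  rewrite <- (is_derive_unique _ _ _ H1). now rewrite <- (is_derive_unique _ _ _ H2). }
assert (b1refl : forall x, b1 (2 * (PI / (2 * theta)) - x) = - b1 x).
{ intros x. apply Ropp_eq_reg. rewrite Ropp_involutive.
  assert (H1 := is_derive_reflect b b1 (2 * (PI / (2 * theta))) x Db).
  rewrite <- (is_derive_unique _ _ _ H1). rewrite <- (is_derive_unique _ _ _ (Db x)).
  apply Derive_ext. exact brefl. }
apply (fold_ind (PI / (2 * theta))); [exact HL| | |].
- intros x Hx. destruct (HbL x Hx) as [-> ->].
  destruct (Hw (PI / (2 * theta) - x)) as [H1 H2]; [lra|].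
  rewrite cos_reflect in H1 by exact Ht. rewrite sin_reflect in H2 by exact Ht.
  split; [exact H1|]. rewrite <- Rabs_Ropp.
  now replace (- (- w1 (PI / (2 * theta) - x) - r * theta * cos (theta * x))) with
    (w1 (PI / (2 * theta) - x) - - (r * theta * cos (theta * x))) by ring.
- intros x [H1 H2]. rewrite bopp, b1opp, <- Ropp_mult_distr_r, sin_neg, cos_neg.
  split; [|exact H2]. rewrite <- Rabs_Ropp.
  now replace (- (- b x - r * - sin (theta * x))) with (b x - r * sin (theta * x)) by ring.
- intros x [H1 H2]. rewrite brefl, b1refl.
  replace (theta * (2 * (PI / (2 * theta)) - x)) with (PI - theta * x) by (field; lra).
  rewrite sin_PI_x, (Rtrigo_facts.cos_pi_minus (theta * x)). split; [exact H1|].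
  rewrite <- Rabs_Ropp.
  now replace (- (- b1 x - r * theta * - cos (theta * x))) with (b1 x - r * theta * cos (theta * x)) by ring.
Qed.

(** * Norm estimates and conclusion *)

Lemma norm_pair_le (a b M : R) : Rabs a <= M -> Rabs b <= M -> norm (a, b) <= 2 * M.
Proof.
intros Ha Hb. assert (HM : 0 <= M) by (generalize (Rabs_pos a); lra).
change (norm (a, b)) with (sqrt (Rabs a ^ 2 + Rabs b ^ 2)).
rewrite <- (sqrt_pow2 (2 * M)) by lra. apply sqrt_le_1_alt.
assert (Rabs a ^ 2 <= M ^ 2) by (apply pow_incr; split; [apply Rabs_pos|exact Ha]).
assert (Rabs b ^ 2 <= M ^ 2) by (apply pow_incr; split; [apply Rabs_pos|exact Hb]).
generalize (pow2_ge_0 M). lra.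
Qed.

Lemma sup_norm_bound (v : R -> R * R) (M : R) : (forall x, norm (v x) <= M) ->
  exists s, sup_norm v = Finite s /\ 0 <= s <= M.
Proof.
intros H. unfold sup_norm.
destruct (Lub_Rbar_correct (fun r => exists x : R, r = norm (v x))) as [Hub Hlub].
(* One attained value keeps the supremum away from minus infinity and makes it nonnegative. *)
assert (H1 := Hub (norm (v 0)) (ex_intro _ 0 eq_refl)).
assert (H2 : Rbar_le (Lub_Rbar (fun r => exists x : R, r = norm (v x))) (Finite M)).
{ apply Hlub. intros y [x ->]. apply H. }
destruct (Lub_Rbar _) as [s| |]; simpl in *; try easy.
exists s. split; [reflexivity|]. generalize (norm_ge_0 (v 0)). lra.
Qed.

Lemma C1_norm_bound (v : R -> R * R) (M : R) : (forall x, norm (v x) <= M) ->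
  (forall x, norm (curve_Derive_n v 1 x) <= M) -> exists s, C1_norm v = Finite s /\ 0 <= s <= 2 * M.
Proof.
intros H1 H2. destruct (sup_norm_bound _ _ H1) as [s [Es Hs]].
destruct (sup_norm_bound _ _ H2) as [t [Et Ht]].
exists (s + t). unfold C1_norm. rewrite Es, Et. split; [reflexivity|lra].
Qed.

Lemma solution_near_circle (theta : R) : 0 < theta < / 2 ->
  exists C, 0 < C /\ forall eps, 0 < eps < 1 -> exists u : R -> R * R,
    (classical_solution eps u /\
     periodic (2 * PI / theta) u /\
     (forall x : R, 0 < x < PI / (2 * theta) ->
        fst (u (PI / (2 * theta) - x)) = snd (u x) /\ 0 < snd (u x)) /\
     (forall x : R, fst (u (- x)) = fst (u x) /\ snd (u (- x)) = - snd (u x))) /\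
    exists s, C1_norm (fun x => minus (u x) (u_circ theta x)) = Finite s /\ 0 <= s <= C * sqrt eps.
Proof.
intros Ht. assert (Ht0 : 0 < theta) by lra.
assert (Hth2 : theta ^ 2 < 1) by (simpl; nra).
set (r := sqrt (1 - theta ^ 2)).
assert (Hr : 0 < r) by (apply sqrt_lt_R0; lra).
assert (Hr2 : r ^ 2 = 1 - theta ^ 2) by (apply pow2_sqrt; lra).
destruct (quarter_convergence theta r Ht0 Hr Hr2) as [C [HC Hconv]].
(* One factor 2 passes from components to the Euclidean norm, the other adds the two suprema of the
   [C1_norm]. *)
exists (4 * C). split; [lra|]. intros eps He.
destruct (quarter_existence eps theta He Ht) as [w [w1 [f Hqs]]].
destruct (global_extension eps theta w w1 f Ht0 Hqs) as [b [b1 [b2 [Hgs HbL]]]].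
assert (Hnear := global_convergence eps theta r (C * sqrt eps) b b1 b2 w w1 Ht0 Hgs HbL
  (Hconv eps w w1 f He Hqs)).
assert (Hper := global_periodic _ _ _ _ _ Hgs).
destruct (global_classical _ _ _ _ _ Hgs) as [Hsol [Hd1 Hd2]].
set (L := PI / (2 * theta)) in *.
exists (fun x => (b (L - x), b x)). split; [split; [exact Hsol|split; [|split]]|].
- intros x. replace (2 * PI / theta) with (4 * L) by (unfold L; field; lra).
  rewrite Hper. f_equal. replace (L - x) with (L - (x + 4 * L) + 4 * L) by ring. now rewrite Hper.
- intros x Hx. simpl. split; [f_equal; ring|].
  destruct (HbL x) as [-> _]; [lra|]. apply (qs_pos _ _ _ _ _ Hqs). fold L. lra.
- intros x. simpl. split; [|apply (gs_opp _ _ _ _ _ Hgs)].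
  rewrite <- (gs_reflect _ _ _ _ _ Hgs). f_equal. ring.
- assert (Hcos : forall x, r * cos (theta * x) = r * sin (theta * (L - x))).
  { intros x. unfold L. now rewrite sin_reflect. }
  replace (4 * C * sqrt eps) with (2 * (2 * (C * sqrt eps))) by ring.
  apply C1_norm_bound; intros x.
  + apply norm_pair_le; [|apply Hnear].
    change (Rabs (b (L - x) - r * cos (theta * x)) <= C * sqrt eps).
    rewrite Hcos. apply Hnear.
  + unfold curve_Derive_n. apply norm_pair_le.
    * change (Rabs (Derive (fun t => b (L - t) - r * cos (theta * t)) x) <= C * sqrt eps).
      rewrite (is_derive_unique _ x (- b1 (L - x) - - (r * theta * sin (theta * x)))).
      -- rewrite <- Rabs_Ropp. destruct (Hnear (L - x)) as [_ H].
         unfold L in H at 2. rewrite cos_reflect in H by exact Ht0.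
         now replace (- (- b1 (L - x) - - (r * theta * sin (theta * x))))
           with (b1 (L - x) - r * theta * sin (theta * x)) by ring.
      -- apply (is_derive_minus (fun t => b (L - t)) (fun t => r * cos (theta * t))).
         ++ apply is_derive_reflect. apply (gs_b _ _ _ _ _ Hgs).
         ++ apply is_derive_cos_scal.
    * change (Rabs (Derive (fun t => b t - r * sin (theta * t)) x) <= C * sqrt eps).
      rewrite (is_derive_unique _ x (b1 x - r * theta * cos (theta * x))); [apply Hnear|].
      apply (is_derive_minus b (fun t => r * sin (theta * t))).
      -- apply (gs_b _ _ _ _ _ Hgs).
      -- apply is_derive_sin_scal.
Qed.

Theorem proposition1 :
  exists theta0 : R, 0 < theta0 < 1 /\
  forall theta : R, 0 < theta < theta0 ->
  exists U : R -> R -> R * R,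
    (forall eps : R, 0 < eps < 1 ->
       classical_solution eps (U eps) /\
       periodic (2 * PI / theta) (U eps) /\
       (forall x : R, 0 < x < PI / (2 * theta) ->
          fst (U eps (PI / (2 * theta) - x)) = snd (U eps x) /\
          0 < snd (U eps x)) /\
       (forall x : R,
          fst (U eps (- x)) = fst (U eps x) /\
          snd (U eps (- x)) = - snd (U eps x))) /\
    filterlim (fun eps : R => C1_norm (fun x => minus (U eps x) (u_circ theta x)))
      (at_right 0) (filtermap Finite (locally 0)).
Proof.
exists (/ 2). split; [lra|]. intros theta Ht.
destruct (solution_near_circle theta Ht) as [C [HC H]].
destruct (choice (fun eps (u : R -> R * R) => 0 < eps < 1 ->
    (classical_solution eps u /\
     periodic (2 * PI / theta) u /\
     (forall x : R, 0 < x < PI / (2 * theta) ->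
        fst (u (PI / (2 * theta) - x)) = snd (u x) /\ 0 < snd (u x)) /\
     (forall x : R, fst (u (- x)) = fst (u x) /\ snd (u (- x)) = - snd (u x))) /\
    exists s, C1_norm (fun x => minus (u x) (u_circ theta x)) = Finite s /\ 0 <= s <= C * sqrt eps)) as [U HU].
{ intros eps. destruct (classic (0 < eps < 1)) as [He|He].
  - destruct (H eps He) as [u Hu]. now exists u.
  (* [choice] needs a curve for every real [eps]; outside (0, 1) the zero curve serves as a
     default. *)
  - now exists (fun _ => (0, 0)). }
exists U. split.
- intros eps He. apply (HU eps He).
- intros P [d Hd].
  (* The first bound keeps [eps] in (0, 1), the second makes [C * sqrt eps] smaller than [d]. *)
  assert (Hm : 0 < Rmin 1 ((d / C) ^ 2)).
  { apply Rmin_pos; [lra|]. apply pow_lt, Rdiv_lt_0_compat; [apply cond_pos|exact HC]. }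
  exists (mkposreal _ Hm). intros eps Heps Hpos.
  assert (Hball : Rabs (eps - 0) < Rmin 1 ((d / C) ^ 2)) by exact Heps.
  rewrite Rminus_0_r, Rabs_pos_eq in Hball by lra.
  assert (He1 := Rlt_le_trans _ _ _ Hball (Rmin_l _ _)).
  assert (He2 := Rlt_le_trans _ _ _ Hball (Rmin_r _ _)).
  destruct (HU eps (conj Hpos He1)) as [_ [s [Es Hs]]].
  change (P (C1_norm (fun x => minus (U eps x) (u_circ theta x)))). rewrite Es.
  apply Hd. change (Rabs (s - 0) < d). rewrite Rminus_0_r, Rabs_pos_eq by lra.
  apply Rle_lt_trans with (1 := proj2 Hs).
  assert (Hsq : sqrt eps < d / C).
  { rewrite <- (sqrt_pow2 (d / C)); [apply sqrt_lt_1_alt; lra|].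
    left. apply Rdiv_lt_0_compat; [apply cond_pos|exact HC]. }
  replace (pos d) with (C * (d / C)) by (field; lra). now apply Rmult_lt_compat_l.
Qed.
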